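(* Let $(X,\mathcal{B},\mu)$ be a probability space and let $T_1,T_2: X \to X$ be commuting, invertible measure preserving transformations such that $T_1$, $T_2$ and $T_1T_2^{-1}$ are ergodic. Then, for all $\varepsilon>0$ and all $A \in \mathcal{B}$, the set $$\{ n \in \mathbb{Z} : \mu(A \cap T_1^{-n}A \cap T_2^{-n}A)>\mu(A)^3-\varepsilon \}$$ is syndetic.
   Context: A subset of $\mathbb{Z}$ is syndetic if it has bounded gaps in $\mathbb{Z}$, i.e. there is $L\in\mathbb{N}$ such that every interval of $L$ consecutive integers meets the set. *)

(* Defs.v *)
From mathcomp Require Import all_boot all_order all_algebra.
From mathcomp Require Import all_classical all_reals all_analysis.

Set Implicit Arguments.
Unset Strict Implicit.
Unset Printing Implicit Defensive.

Import Order.TTheory GRing.Theory Num.Theory.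

Local Open Scope classical_set_scope.
Local Open Scope ring_scope.

Definition measure_preserving (d : measure_display) (X : measurableType d)
    (R : realType) (mu : {measure set X -> \bar R}) (T : X -> X) : Prop :=
  measurable_fun [set: X] T /\
  forall A : set X, measurable A -> mu (T @^-1` A) = mu A.

(* [{splitbij [set: X] >-> [set: X]}] is the type of bijections of [X] bundled
   with their (two-sided) inverse [T^-1%FUN].  Invertibility in the measurable
   category also requires that inverse to be measurable; that it preserves [mu]
   then follows. *)
Definition invertible_measure_preserving (d : measure_display)
    (X : measurableType d) (R : realType) (mu : {measure set X -> \bar R})
    (T : {splitbij [set: X] >-> [set: X]}) : Prop :=
  measure_preserving mu T /\ measurable_fun [set: X] (T^-1)%FUN.

(* Meant for a measure-preserving [T] on a probability space. *)
Definition ergodic (d : measure_display) (X : measurableType d)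
    (R : realType) (mu : {measure set X -> \bar R}) (T : X -> X) : Prop :=
  forall A : set X, measurable A -> T @^-1` A = A ->
    mu A = 0%E \/ mu A = 1%E.

(* [Negz m] is the integer [- m.+1].  The set written [T^{-n} A] is the
   preimage [zpow T n @^-1` A], for every sign of [n]. *)
Definition zpow (X : Type) (T : {splitbij [set: X] >-> [set: X]}) (n : int) :
    X -> X :=
  match n with
  | Posz m => iter m T
  | Negz m => iter m.+1 (T^-1)%FUN
  end.

Definition syndetic (S : set int) : Prop :=
  exists L : nat, forall a : int,
    exists n : int, a <= n < a + L%:Z /\ S n.

(* Main.v *)
Require Import Defs.
From HB Require Import structures.
From mathcomp Require Import all_boot all_order all_algebra.
From mathcomp Require Import all_classical all_reals all_analysis.
From mathcomp Require Import measurable_realfun ring lra zify.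

(* Write [f] for the indicator function of [A].  By van der Corput and the
   ergodicity of [T1 T2^-1], averages of [T1^n r . T2^n f], even with weights
   [exp (i n t)], are controlled by the averages of [|<r, T1^n r>|^2], and by
   Wiener's lemma these are small as soon as [r] is almost orthogonal to the
   eigenfunctions of [T1].  Since [T1] and [T2] commute and are ergodic, they
   have the same eigenfunctions.  Let [p] be almost the projection of [f] to
   their span.  Averaging with a nonnegative trigonometric weight that
   concentrates on the syndetic set of times at which [T1^n p] and [T2^n p]
   are close to [p], the mean of [\int f . T1^n f . T2^n f] is therefore close
   to [\int f p Phi], where [Phi], the weighted mean of [T2^n f], is close to
   [p].  Finally Cauchy-Schwarz gives
   [\int f . \int f Phi^2 >= (\int f Phi)^2], which is close to
   [(\int p^2)^2 >= (\int f)^4].  All estimates are uniform over intervals of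
   a given length, hence syndeticity. *)

Set Implicit Arguments.
Unset Strict Implicit.
Unset Printing Implicit Defensive.

Import Order.TTheory GRing.Theory Num.Theory.
Import numFieldNormedType.Exports.

Local Open Scope classical_set_scope.
Local Open Scope ring_scope.

(** * Bounded measurable functions and their expectation *)

Section bounded_functions.
Context (d : measure_display) (X : measurableType d) (R : realType).

(** Functions are bounded and defined at every point, so that triple products stay integrable. The
    price is that no complete space is at hand: nearly optimal elements of the span replace the
    projection, correlations of [r] replace its spectral measure, and pairs of real functions
    replace complex ones. The obstacle is the order of choices. The weight is built from the
    frequencies of [p], while the residual must be small relative to the coefficients of that
    weight, so [f - p] itself cannot serve. A second, finer approximation [p'] is chosen after the
    weight; the parallelogram law keeps it close to [p], and the residual is [r = f - p']. A
    trigonometric weight can be treated one frequency at a time, because in van der Corput's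
    inequality the twist [exp (i n t)] leaves a factor that depends only on the lag. The factor
    [\int f] cancels from the final inequality, which leaves the cube. *)

Definition bmeas : {pred X -> R} := fun f =>
  `[< measurable_fun [set: X] f /\ exists M : R, forall x, `|f x| <= M >].

Record bfun := BFun { bfun_fun :> X -> R; bfunP : bfun_fun \in bmeas }.

HB.instance Definition _ := [isSub for bfun_fun].
HB.instance Definition _ := [Choice of bfun by <:].

Lemma bmeas_subring_closed : subring_closed bmeas.
Proof.
split=> [|f g /asboolP[mf [M fM]] /asboolP[mg [N gN]]|
         f g /asboolP[mf [M fM]] /asboolP[mg [N gN]]].
- by apply/asboolP; split; [exact: measurable_cst|exists 1 => x; rewrite normr1].
- apply/asboolP; split; first exact: measurable_funB.
  exists (M + N) => x; apply: le_trans (ler_normB _ _) _; exact: lerD.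
- apply/asboolP; split; first exact: measurable_funM.
  exists (M * N) => x; rewrite normrM; exact: ler_pM.
Qed.
HB.instance Definition _ := GRing.isSubringClosed.Build _ bmeas
  bmeas_subring_closed.
HB.instance Definition _ := [SubChoice_isSubComNzRing of bfun by <:].

Lemma bmeas_scaler_closed : scaler_closed bmeas.
Proof.
move=> a f /asboolP[mf [M fM]]; apply/asboolP; split.
  exact: measurable_funM => //; exact: measurable_cst.
by exists (`|a| * M) => x; rewrite normrM ler_wpM2l.
Qed.
HB.instance Definition _ := GRing.isScaleClosed.Build _ _ bmeas
  bmeas_scaler_closed.
HB.instance Definition _ := [SubZmodule_isSubLmodule of bfun by <:].

Implicit Types f g : bfun.

Lemma bfun0E x : (0 : bfun) x = 0. Proof. by []. Qed.
Lemma bfun1E x : (1 : bfun) x = 1. Proof. by []. Qed.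
Lemma bfunDE f g x : (f + g) x = f x + g x. Proof. by []. Qed.
Lemma bfunNE f x : (- f) x = - f x. Proof. by []. Qed.
Lemma bfunME f g x : (f * g) x = f x * g x. Proof. by []. Qed.
Lemma bfunZE (a : R) f x : (a *: f) x = a * f x. Proof. by []. Qed.
Definition bfunE := (bfun0E, bfun1E, bfunDE, bfunNE, bfunME, bfunZE).

Lemma bfun_ext f g : f =1 g -> f = g.
Proof. by move=> fg; apply/val_inj/funext. Qed.

Lemma bfun_scaleAr (c : R) f g : f * (c *: g) = c *: (f * g).
Proof. by apply: bfun_ext => x; rewrite !bfunE mulrCA. Qed.

Lemma measurable_bfun f : measurable_fun [set: X] f.
Proof. by case: f => f /= /asboolP[]. Qed.

Lemma bfun_bounded f : exists M : R, forall x, `|f x| <= M.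
Proof. by case: f => f /= /asboolP[]. Qed.

Lemma bfun_sumE (I : Type) (s : seq I) (P : pred I) (F : I -> bfun) x :
  (\sum_(i <- s | P i) F i) x = \sum_(i <- s | P i) F i x.
Proof.
by elim/big_rec2: _ => // i y f _ <-; rewrite bfunE.
Qed.

End bounded_functions.

Section expectation.
Context (d : measure_display) (X : measurableType d) (R : realType).
Variable mu : probability X R.
Implicit Types f g : bfun X R.

Definition Ex f : R := \int[mu]_x f x.

Lemma bfun_integrable f : mu.-integrable [set: X] (EFin \o f).
Proof.
apply: measurable_bounded_integrable => //.
- by rewrite -ge0_fin_numE//; exact: fin_num_measure.
- exact: measurable_bfun.
- have [M fM] := bfun_bounded f; exists M; split; first exact: num_real.
  by move=> N MN x _ /=; exact: le_trans (fM x) (ltW MN).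
Qed.

Lemma ExD f g : Ex (f + g) = Ex f + Ex g.
Proof. by rewrite /Ex -RintegralD//; exact: bfun_integrable. Qed.

Lemma ExZ (a : R) f : Ex (a *: f) = a * Ex f.
Proof. by rewrite /Ex -RintegralZl//; exact: bfun_integrable. Qed.

Lemma ExN f : Ex (- f) = - Ex f.
Proof. by rewrite -scaleN1r ExZ mulN1r. Qed.

Lemma ExB f g : Ex (f - g) = Ex f - Ex g.
Proof. by rewrite ExD ExN. Qed.

Lemma Ex1 : Ex 1 = 1.
Proof.
have -> : Ex 1 = 1 * fine (mu [set: X]) by exact: Rintegral_cst.
by rewrite probability_setT mulr1.
Qed.

Lemma EFin_Ex f : (Ex f)%:E = (\int[mu]_x (f x)%:E)%E.
Proof.
by rewrite /Ex /Rintegral fineK//; exact: integrable_fin_num (bfun_integrable f).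
Qed.

Lemma Ex_ae f g : {ae mu, forall x, f x = g x} -> Ex f = Ex g.
Proof.
move=> fg; rewrite /Ex /Rintegral; congr fine; apply: ae_eq_integral => //.
- by apply/measurable_EFinP; exact: measurable_bfun.
- by apply/measurable_EFinP; exact: measurable_bfun.
- by apply: filterS fg => x /= ->.
Qed.

Lemma Ex_ge0 f : {ae mu, forall x, 0 <= f x} -> 0 <= Ex f.
Proof.
move=> f0; rewrite -lee_fin EFin_Ex.
rewrite (@ae_eq_integral _ _ _ mu [set: X] (EFin \o (fun x => Num.max 0 (f x)))).
- by apply: integral_ge0 => x _ /=; rewrite lee_fin le_max lexx.
- exact: measurableT.
- by apply/measurable_EFinP; exact: measurable_bfun.
- apply/measurable_EFinP; apply: measurable_maxr; first exact: measurable_cst.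
  exact: measurable_bfun.
- by apply: filterS f0 => x /= fx _; congr EFin; apply/esym/max_idPr.
Qed.

Lemma Ex_le f g : {ae mu, forall x, f x <= g x} -> Ex f <= Ex g.
Proof.
move=> fg; rewrite -subr_ge0 -ExB; apply: Ex_ge0; apply: filterS fg => x fg.
by rewrite !bfunE subr_ge0.
Qed.

Lemma Ex_ge0_eq0 f : {ae mu, forall x, 0 <= f x} -> Ex f = 0 ->
  {ae mu, forall x, f x = 0}.
Proof.
move=> f0 Ef.
have : (\int[mu]_x `|(f x)%:E| = 0)%E.
  rewrite (@ae_eq_integral _ _ _ mu [set: X] (EFin \o f)).
  - by rewrite -EFin_Ex Ef.
  - exact: measurableT.
  - apply: measurableT_comp => //.
    by apply/measurable_EFinP; exact: measurable_bfun.
  - by apply/measurable_EFinP; exact: measurable_bfun.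
  - by apply: filterS f0 => x /= fx _; rewrite ger0_norm.
have mf : measurable_fun [set: X] (EFin \o f).
  by apply/measurable_EFinP; exact: measurable_bfun.
move=> /(ae_eq_integral_abs mu measurableT mf).1; apply: filterS => x /=.
by move=> /(_ I) [].
Qed.

Lemma Ex_sqr_eq0 f : Ex (f * f) = 0 -> {ae mu, forall x, f x = 0}.
Proof.
move=> /Ex_ge0_eq0 H; apply: filterS (H _) => [x /eqP|].
  by rewrite bfunE mulf_eq0 orbb => /eqP.
by apply: aeW => x; rewrite bfunE -expr2 sqr_ge0.
Qed.

(* A subsequence [G] with [E |G (k+1) - G k| <= 2^-k] converges almost
   everywhere; the truncation to [[-C, C]] keeps its upper limit bounded. *)
Lemma bfun_complete (F : nat -> bfun X R) (C : R) :
  (forall n x, `|F n x| <= C) ->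
  (forall e, 0 < e -> exists N, forall m n, (N <= m)%N -> (N <= n)%N ->
     Ex ((F m - F n) * (F m - F n)) <= e) ->
  exists P : bfun X R, forall e, 0 < e -> exists N, forall n, (N <= n)%N ->
     Ex ((F n - P) * (F n - P)) <= e.
Proof.
move=> FC Fcauchy.
have C0 : 0 <= C by apply: le_trans (FC 0%N point).
have /choice [nu nuP] : forall k : nat, exists N, forall m n,
    (N <= m)%N -> (N <= n)%N ->
    Ex ((F m - F n) * (F m - F n)) <= (2^-1 ^+ k) ^+ 2.
  by move=> k; apply: Fcauchy; rewrite !exprn_gt0// invr_gt0.
(* The sum makes [nn l] at least [nu k] for all [k <= l]; the summand [k] makes [nn] unbounded,
   which is used at the end to get past [N]. *)
pose nn k := (k + \sum_(j < k.+1) nu j)%N.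
have nn_le k l : (k <= l)%N -> (nu k <= nn l)%N.
  move=> kl; rewrite /nn (bigD1 (Ordinal (kl : (k < l.+1)%N)))//=.
  by rewrite addnCA leq_addr.
pose G k := F (nn k).
have Gstep k : Ex ((G k - G k.+1) * (G k - G k.+1)) <= (2^-1 ^+ k) ^+ 2.
  by apply: nuP; exact: nn_le.
have mabs k : measurable_fun [set: X] (fun x => `|G k x - G k.+1 x|).
  apply: measurableT_comp => //; exact: (measurable_bfun (G k - G k.+1)).
have absP k : (fun x => `|G k x - G k.+1 x|) \in @bmeas _ X R.
  apply/asboolP; split => //; exists (C + C) => x; rewrite normr_id.
  by apply: le_trans (ler_normB _ _) _; exact: lerD (FC _ _) (FC _ _).
pose D k := BFun (absP k).
have ED k : Ex (D k) <= 2^-1 ^+ k.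
  have ge0 : 0 <= 2^-1 ^+ k :> R by rewrite exprn_ge0.
  rewrite -(@ler_pXn2r _ 2)// ?nnegrE//; last first.
    by apply: Ex_ge0; apply: aeW => x /=.
  apply: le_trans (Gstep k).
  have -> : (G k - G k.+1) * (G k - G k.+1) = D k * D k.
    by apply: bfun_ext => x; rewrite !bfunE /= -[RHS]expr2 real_normK ?num_real// expr2.
  rewrite -subr_ge0.
  have -> : Ex (D k * D k) - Ex (D k) ^+ 2 =
      Ex ((D k - Ex (D k) *: (1 : bfun X R)) * (D k - Ex (D k) *: (1 : bfun X R))).
    have -> : (D k - Ex (D k) *: (1 : bfun X R)) * (D k - Ex (D k) *: (1 : bfun X R)) =
        D k * D k - (2 * Ex (D k)) *: D k + (Ex (D k) ^+ 2) *: (1 : bfun X R).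
      by apply: bfun_ext => x; rewrite !bfunE; ring.
    by rewrite ExD ExB !ExZ Ex1; ring.
  by apply: Ex_ge0; apply: aeW => x; rewrite bfunE -expr2 sqr_ge0.
have sumfin : (\int[mu]_x (\sum_(k <oo) (D k x)%:E) < +oo)%E.
  rewrite integral_nneseries//; last first.
  - by move=> k x _; rewrite lee_fin /=.
  - by move=> k; apply/measurable_EFinP; exact: (measurable_bfun (D k)).
  apply: (@le_lt_trans _ _ 2%:E); last exact: ltry.
  under eq_eseriesr do rewrite -EFin_Ex.
  apply: lime_le.
    apply: is_cvg_nneseries => k _ _; rewrite lee_fin.
    by apply: Ex_ge0; apply: aeW => x /=.
  apply: nearW => n; rewrite sumEFin lee_fin big_mkord.
  apply: (@le_trans _ _ (\sum_(k < n) 2^-1 ^+ k)); first exact: ler_sum.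
  have : \sum_(k < n) 2^-1 ^+ k = 2 - 2 * 2^-1 ^+ n :> R.
    elim: n => [|n IH]; first by rewrite big_ord0 expr0; ring.
    by rewrite big_ord_recr /= IH exprS; field.
  by move=> ->; rewrite lerBlDr lerDl mulr_ge0// exprn_ge0.
have [L [LC LP]] : exists L : bfun X R, (forall x, `|L x| <= C) /\
    {ae mu, forall x, G k x @[k --> \oo] --> L x}.
  have LC x : `|Num.max (- C) (Num.min C (limn_sup (fun k => G k x)))| <= C.
    rewrite ler_norml le_max lexx /= ge_max ge_min lexx /=.
    by rewrite andbT ge0_cp.
  have Lm : (fun x => Num.max (- C) (Num.min C (limn_sup (fun k => G k x))))
      \in @bmeas _ X R.
    apply/asboolP; split.
      apply: measurable_maxr; first exact: measurable_cst.
      apply: measurable_minr; first exact: measurable_cst.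
      apply: measurable_fun_limn_sup.
      - by move=> x _; exists C => _ [k _ <-]; exact: le_trans (ler_norm _) (FC _ _).
      - move=> x _; exists (- C) => _ [k _ <-].
        by have := FC (nn k) x; rewrite ler_norml => /andP[].
      - by move=> k; exact: measurable_bfun.
    by exists C.
  exists (BFun Lm); split => //.
  have : {ae mu, forall x, (\sum_(k <oo) (D k x)%:E) \is a fin_num}%E.
    have := @integrable_ae _ _ _ mu [set: X] measurableT
      (fun x => \sum_(k <oo) (D k x)%:E)%E.
    move=> H; apply: filterS (H _) => [x /(_ I)//|].
    apply/integrableP; split.
      apply: ge0_emeasurable_sum => [k x _ _|k _].
        by rewrite lee_fin /=.
      by apply/measurable_EFinP; exact: measurable_bfun.
    apply: le_lt_trans sumfin; apply: ge0_le_integral => //.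
    - apply: measurableT_comp => //; apply: ge0_emeasurable_sum => [k x _ _|k _].
        by rewrite lee_fin /=.
      by apply/measurable_EFinP; exact: measurable_bfun.
    - apply: ge0_emeasurable_sum => [k x _ _|k _].
        by rewrite lee_fin /=.
      by apply/measurable_EFinP; exact: measurable_bfun.
    - move=> x _; rewrite gee0_abs//; apply: nneseries_ge0 => k _ _.
      by rewrite lee_fin /=.
  apply: filterS => x xfin /=.
  have cvgG : cvgn (fun k => G k x).
    have : cvgn (series (fun k => G k.+1 x - G k x)).
      apply: normed_cvg.
      rewrite -[X in cvgn X]/(series (fun k => `|G k.+1 x - G k x|)).
      apply: nondecreasing_is_cvgn.
        by apply/nondecreasing_seqP => n; rewrite /series /= big_nat_recr //= lerDl.
      exists (fine (\sum_(k <oo) (D k x)%:E)%E) => _ [n _ <-].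
      rewrite -lee_fin fineK// /series /= -sumEFin.
      under eq_bigr do rewrite distrC.
      by apply: (nneseries_lim_ge n) => k _ _; rewrite lee_fin /=.
    rewrite (_ : series _ = (fun n => G n x - G 0%N x)).
      move=> /is_cvgD /(_ (is_cvg_cst (G 0%N x))).
      rewrite (_ : _ + _ = (fun n => G n x))//.
      by apply/funext => n /=; rewrite -[LHS]/(_ + _) subrK.
    by apply/funext => n; rewrite /series /= telescope_sumr.
  have -> : limn_sup (fun k => G k x) = limn (fun k => G k x).
    exact: cvg_limn_supE.
  have lel : limn (fun k => G k x) <= C.
    by apply: limr_le => //; apply: nearW => k; exact: le_trans (ler_norm _) (FC _ _).
  have gel : - C <= limn (fun k => G k x).
    apply: limr_ge => //; apply: nearW => k.
    by have := FC (nn k) x; rewrite ler_norml => /andP[].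
  by rewrite (min_idPr lel) (max_idPr gel).
exists L => e e0.
have GL : ((Ex ((G k - L) * (G k - L)))%:E @[k --> \oo] --> 0)%E.
  have [] := @dominated_convergence _ _ _ mu [set: X] measurableT
    (fun k x => (((G k - L) * (G k - L)) x)%:E) (cst 0%E)
    (cst (((C + C) ^+ 2)%:E)) _ _ _ _ _ => //.
  - by move=> k; apply/measurable_EFinP; exact: measurable_bfun.
  - apply: filterS LP => x GLx _; apply: cvg_EFin; first by apply: nearW.
    rewrite (_ : fine \o _ = (fun k => (G k x - L x) * (G k x - L x)))//.
    rewrite -[X in _ --> X](mulr0 (0 : R)).
    by apply: cvgM; apply/subr_cvg0.
  - exact: (@finite_measure_integrable_cst _ _ _ mu).
  - apply: aeW => x k _; rewrite /= lee_fin normrM expr2.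
    apply: ler_pM => //; apply: le_trans (ler_normB _ _) _;
      exact: lerD (FC _ _) (LC _).
  move=> _ _; rewrite integral0 => H.
  move: H; rewrite /= (_ : (fun n => _) =
    (fun k => (Ex ((G k - L) * (G k - L)))%:E))//.
  by apply/funext => k; rewrite EFin_Ex.
have [k0 Gk0] : exists k0, forall k, (k0 <= k)%N ->
    Ex ((G k - L) * (G k - L)) <= e / 4.
  have e4 : 0 < e / 4 by rewrite divr_gt0.
  move/fine_cvgP: GL => [_] /cvgrPdist_lt /(_ _ e4) [k0 _ k0P].
  exists k0 => k /k0P /=; rewrite sub0r normrN => /ltW; apply: le_trans.
  exact: ler_norm.
have [N FN] := Fcauchy (e / 4) ltac:(by rewrite divr_gt0).
exists N => n Nn.
pose m := maxn k0 N.
have Nm : (N <= nn m)%N.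
  by rewrite (leq_trans (leq_maxr k0 N))// leq_addr.
have := Gk0 m (leq_maxl _ _); have := FN n (nn m) Nn Nm.
have : 0 <= Ex (((F n - G m) - (G m - L)) * ((F n - G m) - (G m - L))).
  by apply: Ex_ge0; apply: aeW => x; rewrite bfunE -expr2 sqr_ge0.
(* The identity [(x + y)^2 = 2 x^2 + 2 y^2 - (x - y)^2] for [x = F n - G m] and [y = G m - L]. *)
have -> : (F n - L) * (F n - L) = 2 *: ((F n - G m) * (F n - G m)) +
   2 *: ((G m - L) * (G m - L)) -
   ((F n - G m) - (G m - L)) * ((F n - G m) - (G m - L)).
  by apply: bfun_ext => x; rewrite !bfunE; ring.
rewrite ExB ExD !ExZ -/(G m); lra.
Qed.

End expectation.

(** * Semi-inner products and averages of sequences *)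

Record semi_ip (R : realType) (V : lmodType R) := SemiIP {
  ip :> V -> V -> R ;
  ipDl : forall x y z, ip (x + y) z = ip x z + ip y z ;
  ipZl : forall a x z, ip (a *: x) z = a * ip x z ;
  ipC : forall x y, ip x y = ip y x ;
  ip_ge0 : forall x, 0 <= ip x x }.

Lemma div_nat_le (R : realType) (c e : R) : 0 < e ->
  exists N : nat, forall n, (N <= n)%N -> c / n%:R <= e.
Proof.
move=> e0; exists (Num.trunc (`|c| / e)).+1 => n Nn.
have n0 : 0 < n%:R :> R by rewrite ltr0n; apply: leq_trans Nn.
rewrite ler_pdivrMr//; apply: le_trans (ler_norm _) _.
rewrite mulrC -ler_pdivrMr//; apply/ltW/(lt_le_trans (truncnS_gt _)).
by rewrite ler_nat.
Qed.

Lemma le_of_div_nat (R : realType) (c x y : R) :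
  (forall n, (0 < n)%N -> x <= y + c / n%:R) -> x <= y.
Proof.
move=> H; apply/ler_addgt0Pr => e e0.
have [N NP] := div_nat_le c e0.
by apply: le_trans (H N.+1 _) _ => //; rewrite lerD2l NP.
Qed.

Section semi_inner_product.
Context (R : realType) (V : lmodType R) (B : semi_ip V).
Implicit Types x y z : V.

Lemma ipDr x y z : B x (y + z) = B x y + B x z.
Proof. by rewrite ipC ipDl !(ipC B x). Qed.

Lemma ipZr a x y : B x (a *: y) = a * B x y.
Proof. by rewrite ipC ipZl ipC. Qed.

Lemma ipNl x y : B (- x) y = - B x y.
Proof. by rewrite -scaleN1r ipZl mulN1r. Qed.

Lemma ipNr x y : B x (- y) = - B x y.
Proof. by rewrite ipC ipNl ipC. Qed.

Lemma ipBl x y z : B (x - y) z = B x z - B y z.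
Proof. by rewrite ipDl ipNl. Qed.

Lemma ipBr x y z : B x (y - z) = B x y - B x z.
Proof. by rewrite ipDr ipNr. Qed.

Lemma ip0l x : B 0 x = 0.
Proof. by rewrite -(scale0r 0) ipZl mul0r. Qed.

Lemma ip_suml (I : Type) (s : seq I) (P : pred I) (F : I -> V) y :
  B (\sum_(i <- s | P i) F i) y = \sum_(i <- s | P i) B (F i) y.
Proof.
elim/big_rec2: _ => [|i c x _ <-]; first exact: ip0l.
exact: ipDl.
Qed.

Lemma ip_sumr (I : Type) (s : seq I) (P : pred I) (F : I -> V) y :
  B y (\sum_(i <- s | P i) F i) = \sum_(i <- s | P i) B y (F i).
Proof. by rewrite ipC ip_suml; apply: eq_bigr => i _; rewrite ipC. Qed.

Lemma ip_cs2 x y : B x y ^+ 2 <= B x x * B y y.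
Proof.
have H (a : R) : 0 <= B x x - a * B x y *+ 2 + a ^+ 2 * B y y.
  have := ip_ge0 B (x - a *: y).
  rewrite ipBl !ipBr !ipZl !ipZr (ipC B y x).
  by congr (0 <= _); ring.
have [y0|y0] := eqVneq (B y y) 0.
  suff -> : B x y = 0 by rewrite expr0n y0 mulr0.
  apply/eqP; apply: contraT => xy0.
  have := H ((B x x + 1) / (2 * B x y)); rewrite y0 mulr0 addr0.
  have -> : B x x - (B x x + 1) / (2 * B x y) * B x y *+ 2 = - 1 by field.
  by rewrite ler0N1.
have y1 : 0 < B y y by rewrite lt_def y0 ip_ge0.
have := H (B x y / B y y); rewrite -(@pmulr_lge0 _ (B y y))//.
rewrite -(subr_ge0 (B x y ^+ 2)); congr (0 <= _); field; exact/lt0r_neq0.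
Qed.

Definition ipn x : R := Num.sqrt (B x x).

Lemma ipn_ge0 x : 0 <= ipn x. Proof. exact: sqrtr_ge0. Qed.
Hint Resolve ipn_ge0 : core.

Lemma ipn_sqr x : ipn x ^+ 2 = B x x.
Proof. by rewrite sqr_sqrtr// ip_ge0. Qed.

Lemma ipn_le x (c : R) : 0 <= c -> (ipn x <= c) = (B x x <= c ^+ 2).
Proof. by move=> c0; rewrite -ipn_sqr ler_pXn2r// nnegrE. Qed.

Lemma ip_cs x y : `|B x y| <= ipn x * ipn y.
Proof.
rewrite -(@ler_pXn2r _ 2)// ?nnegrE ?mulr_ge0//.
by rewrite real_normK ?num_real// exprMn !ipn_sqr ip_cs2.
Qed.

Lemma ip_le x y : B x y <= ipn x * ipn y.
Proof. exact: le_trans (ler_norm _) (ip_cs x y). Qed.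

Lemma ipnZ a x : ipn (a *: x) = `|a| * ipn x.
Proof.
by rewrite /ipn ipZl ipZr mulrA -expr2 sqrtrM ?sqr_ge0// sqrtr_sqr.
Qed.

Lemma ipnN x : ipn (- x) = ipn x.
Proof. by rewrite /ipn ipNl ipNr opprK. Qed.

Lemma ipnBC x y : ipn (x - y) = ipn (y - x).
Proof. by rewrite -ipnN opprB. Qed.

Lemma ipn0 : ipn 0 = 0.
Proof. by rewrite /ipn ip0l sqrtr0. Qed.

Lemma ipnD x y : ipn (x + y) <= ipn x + ipn y.
Proof.
rewrite ipn_le ?addr_ge0// ipDl !ipDr (ipC B y x) -!ipn_sqr.
have := ip_le x y; nra.
Qed.

Lemma ipnB x y : ipn (x - y) <= ipn x + ipn y.
Proof. by rewrite -[ipn y]ipnN ipnD. Qed.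

Lemma ipn_split y x z : ipn (x - z) <= ipn (x - y) + ipn (y - z).
Proof. by apply: le_trans (ipnD _ _); rewrite addrA subrK. Qed.

Lemma ipn_leD x y : ipn x <= ipn y + ipn (x - y).
Proof. by apply: le_trans (ipnD _ _); rewrite addrC subrK. Qed.

Lemma ipn_sum (I : Type) (s : seq I) (P : pred I) (F : I -> V) :
  ipn (\sum_(i <- s | P i) F i) <= \sum_(i <- s | P i) ipn (F i).
Proof.
elim/big_rec2: _ => [|i c x _ h]; first by rewrite ipn0.
by apply: le_trans (ipnD _ _) _; rewrite lerD2l.
Qed.

Lemma parallelogram x y :
  ipn (x - y) ^+ 2 = 2 * ipn x ^+ 2 + 2 * ipn y ^+ 2 - ipn (x + y) ^+ 2.
Proof. rewrite !ipn_sqr ipBl ipDl !ipBr !ipDr (ipC B y x); ring. Qed.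

Lemma ipn_sum_sqr (n : nat) (F : 'I_n -> V) :
  ipn (\sum_(i < n) F i) ^+ 2 <= n%:R * \sum_(i < n) ipn (F i) ^+ 2.
Proof.
apply: (@le_trans _ _ ((\sum_(i < n) ipn (F i)) ^+ 2)).
  by rewrite ler_pXn2r ?nnegrE ?sumr_ge0// ipn_sum.
elim: n F => [F|n IH F]; first by rewrite !big_ord0 expr0n mul0r.
rewrite !big_ord_recr /= sqrrD.
have := IH (fun i => F (widen_ord (leqnSn n) i)).
set s := \sum_(i < n) _; set q := \sum_(i < n) _; set a := ipn _ => sq.
have q0 : 0 <= q by rewrite sumr_ge0// => i _; rewrite sqr_ge0.
have -> : n.+1%:R * (q + a ^+ 2) = n%:R * q + (q + n%:R * a ^+ 2) + a ^+ 2.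
  by rewrite -natr1; ring.
rewrite lerD2r lerD//.
have [n0|n0] := posnP n.
  have : s ^+ 2 <= 0 by rewrite (le_trans sq)// n0 mul0r.
  rewrite exprn_even_le0//= => /eqP ->.
  by rewrite mul0r mul0rn n0 mul0r addr0.
have nR : 0 < n%:R :> R by rewrite ltr0n.
(* After multiplication by [n], the claim [2 s a <= q + n a^2] follows from [(s - n a)^2 >= 0] and
   [s^2 <= n q]. *)
rewrite -(ler_pM2l nR).
have := sqr_ge0 (s - n%:R * a); rewrite -(mulr_natr _ 2); nra.
Qed.

(* Averages of sequences indexed by [int] over [[a, a + n)]; for [n = 0] the
   junk value is [0]. *)
Definition avg (W : lmodType R) (u : int -> W) (a : int) (n : nat) : W :=
  n%:R^-1 *: \sum_(i < n) u (a + i%:Z).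

Lemma ipn_avg (u : int -> V) a n c : 0 <= c -> (forall k, ipn (u k) <= c) ->
  ipn (avg u a n) <= c.
Proof.
move=> c0 uc; rewrite /avg ipnZ ger0_norm ?invr_ge0//.
case: n => [|n]; first by rewrite invr0 mul0r.
rewrite ler_pdivrMl ?ltr0n//; apply: le_trans (ipn_sum _ _ _) _.
rewrite mulrC; apply: le_trans (ler_sum _ (fun i _ => uc _)) _.
by rewrite sumr_const card_ord mulr_natr.
Qed.

Lemma ipn_avg_sqr (u : int -> V) a n :
  ipn (avg u a n) ^+ 2 <= avg (fun k => ipn (u k) ^+ 2 : R^o) a n.
Proof.
rewrite {1}/avg ipnZ exprMn real_normK ?num_real//.
apply: le_trans (ler_wpM2l (sqr_ge0 _) (ipn_sum_sqr _)) _.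
case: n => [|n]; first by rewrite big_ord0 mulr0 mulr0 /avg big_ord0 scaler0.
rewrite mulrA expr2 -(mulrA _ _ n.+1%:R) mulVf ?mulr1//.
Qed.

Section bounded_sequence.
Variables (u : int -> V) (C : R).
Hypothesis uC : forall k, ipn (u k) <= C.

Let C0 : 0 <= C. Proof. exact: le_trans (uC 0). Qed.

(** A shift by one exchanges a single term of the window, at a cost of at most [2 * C / n]. The
    bound is independent of [a], and this is where the uniformity over intervals begins. *)
Lemma avg_shift a n (j : nat) :
  ipn (avg u (a + j%:Z) n - avg u a n) <= 2 * j%:R * C / n%:R.
Proof.
elim: j => [|j IH]; first by rewrite addr0 subrr ipn0 mulr0 !mul0r.
apply: le_trans (ipn_split (avg u (a + j%:Z) n) _ _) _.
have -> : 2 * j.+1%:R * C / n%:R = 2 * C / n%:R + 2 * j%:R * C / n%:R.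
  by rewrite -natr1; ring.
apply: lerD IH; rewrite /avg -scalerBr ipnZ ger0_norm ?invr_ge0// mulrC.
rewrite ler_wpM2r ?invr_ge0//.
have -> : \sum_(i < n) u (a + j.+1 + i) - \sum_(i < n) u (a + j + i) =
    u (a + j + n) - u (a + j).
  case: n => [|n]; first by rewrite !big_ord0 addr0 !subrr.
  rewrite big_ord_recr /= [X in _ - X]big_ord_recl /= addr0.
  rewrite (eq_bigr (fun i : 'I_n => u (a + j + bump 0 i))); last first.
    by move=> i _; congr u; rewrite /bump; lia.
  have cancel (S x y : V) : S + x - (y + S) = x - y.
    by rewrite (addrC S) opprD addrA addrAC addrK.
  by rewrite cancel; congr (u _ - _); lia.
by apply: le_trans (ipnB _ _) _; rewrite mulr_natl mulr2n lerD.
Qed.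

Lemma avg_avg a n (m : nat) : (0 < m)%N ->
  ipn (avg u a n - avg (fun k => avg u k m) a n) <= 2 * m%:R * C / n%:R.
Proof.
move=> m0; have mR : m%:R != 0 :> R by rewrite pnatr_eq0 -lt0n.
have -> : avg (fun k => avg u k m) a n =
    m%:R^-1 *: \sum_(j < m) avg u (a + j%:Z) n.
  rewrite /avg -!scaler_sumr !scalerA mulrC exchange_big /=; congr (_ *: _).
  by do 2!apply: eq_bigr => ? _; congr u; rewrite addrAC.
have -> : avg u a n - m%:R^-1 *: \sum_(j < m) avg u (a + j%:Z) n =
    m%:R^-1 *: \sum_(j < m) (avg u a n - avg u (a + j%:Z) n).
  rewrite sumrB sumr_const card_ord scalerBr -[avg u a n *+ _]scaler_nat scalerA mulVf//.
  by rewrite scale1r.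
rewrite ipnZ ger0_norm ?invr_ge0// ler_pdivrMl ?ltr0n//.
apply: le_trans (ipn_sum _ _ _) _.
apply: (@le_trans _ _ (\sum_(j < m) (2 * m%:R * C / n%:R))).
  apply: ler_sum => j _; rewrite ipnBC; apply: le_trans (avg_shift _ _ _) _.
  rewrite ler_wpM2r ?invr_ge0// ler_wpM2r// ler_wpM2l// ler_nat.
  exact: ltnW.
by rewrite sumr_const card_ord -[_ *+ m]mulr_natl.
Qed.

(** Averaging over short windows first costs only an edge effect; Cauchy-Schwarz then brings in
    squared norms of short averages, which expand into correlations of bounded lag. *)
Lemma van_der_corput a n (m : nat) : (0 < m)%N ->
  ipn (avg u a n) <= 2 * m%:R * C / n%:R +
    Num.sqrt (avg (fun k => ipn (avg u k m) ^+ 2 : R^o) a n).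
Proof.
move=> m0.
apply: le_trans (ipn_leD _ (avg (fun k => avg u k m) a n)) _.
rewrite addrC; apply: lerD; first exact: avg_avg.
rewrite -[leLHS]ger0_norm// -sqrtr_sqr ler_wsqrtr//.
exact: ipn_avg_sqr.
Qed.

End bounded_sequence.

(** * A mean ergodic theorem for sequences with stationary inner products *)

Section stationary_sequence.
Variable x : int -> V.
Hypothesis xst : forall k m n, B (x (m + k)) (x (n + k)) = B (x m) (x n).

Lemma stationary_ipn k : ipn (x k) = ipn (x 0).
Proof. by rewrite /ipn -(xst k 0 0) add0r. Qed.

Lemma stationary_avg_ip a n b m k :
  B (avg x (a + k) n) (avg x (b + k) m) = B (avg x a n) (avg x b m).
Proof.
rewrite /avg !ipZl !ipZr; congr (_ * (_ * _)).
rewrite !ip_suml; apply: eq_bigr => i _; rewrite !ip_sumr.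
by apply: eq_bigr => j _; rewrite !(addrAC _ k) xst.
Qed.

Lemma stationary_avg_ipn a n : ipn (avg x a n) = ipn (avg x 0 n).
Proof. by rewrite /ipn -(stationary_avg_ip 0 n 0 n a) add0r. Qed.

(** Let [dd] be the infimum of the norms of averages. Long averages have norm close to [dd], while
    the sum of any two averages has norm at least [2 * dd]; the parallelogram law then makes long
    averages close to each other. *)
Lemma mean_ergodic e : 0 < e -> exists N, forall n m a b,
  (N <= n)%N -> (N <= m)%N -> ipn (avg x a n - avg x b m) <= e.
Proof.
move=> e0.
have xC k : ipn (x k) <= ipn (x 0) by rewrite stationary_ipn.
set C := ipn (x 0) in xC *.
have C0 : 0 <= C by rewrite /C.
pose S : set R := [set ipn (avg x 0 n) | n in [set n : nat | (0 < n)%N]].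
have S0 : S !=set0 by exists (ipn (avg x 0 1)); exists 1%N.
have lbS : has_lbound S by exists 0 => _ [n _ <-].
pose dd := inf S.
have dle n a : (0 < n)%N -> dd <= ipn (avg x a n).
  by move=> n0; rewrite stationary_avg_ipn; apply: ge_inf => //; exists n.
have d0 : 0 <= dd by apply: lb_le_inf => // _ [n _ <-].
have dC : dd <= C.
  by apply: le_trans (dle 1%N 0 isT) _; exact: ipn_avg.
(* Translating both windows does not change the norm of the sum. The mean of the first [K]
   translates is almost twice the average over [[a, a + K)], whose norm is at least [dd], with an
   error of order [1 / K]. *)
have mid_wlog a b n m (j : nat) : b = a + j%:Z -> (0 < n)%N -> (0 < m)%N ->
    2 * dd <= ipn (avg x a n + avg x b m).
  move=> bE n0 m0.
  apply: (@le_of_div_nat _ (2 * n%:R * C + 2 * m%:R * C + 2 * j%:R * C)) => K K0.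
  pose z k := avg x (a + k) n + avg x (b + k) m.
  have zE k : ipn (z k) = ipn (avg x a n + avg x b m).
    by rewrite /ipn /z !(ipDl, ipDr) !stationary_avg_ip.
  have H1 := avg_avg xC a K n0.
  have H2 := avg_avg xC b K m0.
  have H3 := avg_shift xC a K j; rewrite -bE in H3.
  have zavg : avg z 0 K = avg (fun k => avg x k n) a K + avg (fun k => avg x k m) b K.
    rewrite /avg -scalerDr -big_split /=; congr (_ *: _).
  have Hz : ipn (avg z 0 K) <= ipn (avg x a n + avg x b m).
    by apply: ipn_avg => // k; rewrite zE.
  have da := dle K a K0.
  have key : ipn (avg x a K + avg x a K) <= ipn (avg z 0 K) +
     (2 * n%:R * C / K%:R + 2 * m%:R * C / K%:R + 2 * j%:R * C / K%:R).
    apply: le_trans (ipn_leD _ (avg z 0 K)) _; rewrite lerD2l zavg.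
    set u1 := avg _ a K; set u2 := avg (fun _ => avg x _ n) _ _ in H1 *.
    set u3 := avg _ b K in H2 H3 *.
    set u4 := avg (fun _ => avg x _ m) _ _ in H2 *.
    rewrite opprD addrACA; apply: le_trans (ipnD _ _) _.
    rewrite -addrA; apply: lerD => //.
    by apply: le_trans (ipn_split u3 _ _) _; rewrite addrC lerD// ipnBC.
  have e2 : ipn (avg x a K + avg x a K) = 2 * ipn (avg x a K).
    by rewrite -mulr2n -scaler_nat ipnZ ger0_norm.
  rewrite e2 in key; rewrite !mulrDl; lra.
have mid a b n m : (0 < n)%N -> (0 < m)%N -> 2 * dd <= ipn (avg x a n + avg x b m).
  move=> n0 m0; have [ab|/ltW ba] := lerP a b.
    by apply: (@mid_wlog _ _ _ _ `|b - a|%N) => //; lia.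
  rewrite addrC; apply: (@mid_wlog _ _ _ _ `|a - b|%N) => //; lia.
(* The parallelogram law will leave [4 (dd + 2 e1)^2 - 4 dd^2 = 16 e1 (dd + e1)], where [dd <= C]
   and [e1 <= 1]. *)
pose e1 := Num.min 1 (e ^+ 2 / (16 * (C + 1))).
have e10 : 0 < e1 by rewrite lt_min ltr01 divr_gt0 ?exprn_gt0// mulr_gt0// ltr_wpDl.
have [M M0 eM] : exists2 M, (0 < M)%N & ipn (avg x 0 M) < dd + e1.
  have [_ [M M0 <-] h] := inf_adherent e10 (conj S0 lbS).
  by exists M.
have [N NP] := div_nat_le (2 * M%:R * C) e10.
have bound n a : (N.+1 <= n)%N -> ipn (avg x a n) <= dd + 2 * e1.
  move=> Nn; apply: le_trans (ipn_leD _ (avg (fun k => avg x k M) a n)) _.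
  have := avg_avg xC a n M0; have := NP n (ltnW Nn).
  have : ipn (avg (fun k => avg x k M) a n) <= ipn (avg x 0 M).
    by apply: ipn_avg => // k; rewrite stationary_avg_ipn.
  lra.
exists N.+1 => n m a b Nn Nm.
rewrite (ipn_le _ (ltW e0)) -ipn_sqr parallelogram.
have h1 := bound n a Nn; have h2 := bound m b Nm.
have h3 := mid a b n m (leq_ltn_trans (leq0n _) Nn) (leq_ltn_trans (leq0n _) Nm).
have e11 : e1 <= 1 by rewrite ge_min lexx.
have e12 : e1 * (16 * (C + 1)) <= e ^+ 2.
  by rewrite -ler_pdivlMr ?ge_min ?lexx ?orbT// mulr_gt0// ltr_wpDl.
have p0 := ipn_ge0 (avg x a n); have q0 := ipn_ge0 (avg x b m).
have h1' : ipn (avg x a n) ^+ 2 <= (dd + 2 * e1) ^+ 2.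
  by rewrite ler_pXn2r// nnegrE; lra.
have h2' : ipn (avg x b m) ^+ 2 <= (dd + 2 * e1) ^+ 2.
  by rewrite ler_pXn2r// nnegrE; lra.
have h3' : (2 * dd) ^+ 2 <= ipn (avg x a n + avg x b m) ^+ 2.
  by rewrite ler_pXn2r// nnegrE; lra.
apply: le_trans e12; nra.
Qed.

End stationary_sequence.

End semi_inner_product.
#[global] Hint Extern 0 (is_true (0 <= ipn _ _)) => exact: ipn_ge0 : core.

(** * Measure preserving integer actions *)

Section L2.
Context (d : measure_display) (X : measurableType d) (R : realType).
Variable mu : probability X R.
Local Notation V := (bfun X R).
Implicit Types f g h : V.

Fact l2_Dl f g h : Ex mu ((f + g) * h) = Ex mu (f * h) + Ex mu (g * h).
Proof. by rewrite mulrDl ExD. Qed.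

Fact l2_Zl a f h : Ex mu ((a *: f) * h) = a * Ex mu (f * h).
Proof.
by rewrite -ExZ; congr Ex; apply: bfun_ext => x; rewrite !bfunE mulrA.
Qed.

Fact l2_C f g : Ex mu (f * g) = Ex mu (g * f).
Proof. by rewrite mulrC. Qed.

Fact l2_ge0 f : 0 <= Ex mu (f * f).
Proof. by apply: Ex_ge0; apply: aeW => x; rewrite bfunE -expr2 sqr_ge0. Qed.

Definition l2 : semi_ip V := locked (SemiIP l2_Dl l2_Zl l2_C l2_ge0).

Lemma l2E f g : l2 f g = Ex mu (f * g). Proof. by rewrite /l2 -lock. Qed.

Fact l2p_Dl (x y z : V * V) :
  l2 (x + y).1 z.1 + l2 (x + y).2 z.2 =
  (l2 x.1 z.1 + l2 x.2 z.2) + (l2 y.1 z.1 + l2 y.2 z.2).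
Proof. by rewrite !ipDl addrACA. Qed.

Fact l2p_Zl a (x z : V * V) :
  l2 (a *: x).1 z.1 + l2 (a *: x).2 z.2 = a * (l2 x.1 z.1 + l2 x.2 z.2).
Proof. by rewrite !ipZl mulrDr. Qed.

Fact l2p_C (x y : V * V) :
  l2 x.1 y.1 + l2 x.2 y.2 = l2 y.1 x.1 + l2 y.2 x.2.
Proof. by rewrite !(ipC l2 x.1, ipC l2 x.2). Qed.

Fact l2p_ge0 (x : V * V) : 0 <= l2 x.1 x.1 + l2 x.2 x.2.
Proof. by rewrite addr_ge0// ip_ge0. Qed.

(* [V * V] plays the role of the complex-valued bounded functions. *)
Definition l2p : semi_ip (V * V)%type := 
  locked (SemiIP l2p_Dl l2p_Zl l2p_C l2p_ge0).

Lemma l2pE (x y : V * V) : l2p x y = l2 x.1 y.1 + l2 x.2 y.2.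
Proof. by rewrite /l2p -lock. Qed.

Lemma ipn_fst (x : V * V) : ipn l2 x.1 <= ipn l2p x.
Proof. by rewrite /ipn ler_wsqrtr// l2pE lerDl ip_ge0. Qed.

Lemma ipn_snd (x : V * V) : ipn l2 x.2 <= ipn l2p x.
Proof. by rewrite /ipn ler_wsqrtr// l2pE lerDr ip_ge0. Qed.

Lemma ipn_mul_le f g (C : R) : (forall x, `|f x| <= C) ->
  ipn l2 (f * g) <= C * ipn l2 g.
Proof.
move=> fC; have C0 : 0 <= C by apply: le_trans (fC point).
rewrite ipn_le ?mulr_ge0// exprMn ipn_sqr !l2E -ExZ; apply: Ex_le.
apply: aeW => x; rewrite !bfunE -!expr2 exprMn ler_wpM2r ?sqr_ge0//.
by rewrite -[f x ^+ 2]real_normK ?num_real// ler_pXn2r// nnegrE.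
Qed.

Lemma Ex_l2 f : Ex mu f = l2 f 1. Proof. by rewrite l2E mulr1. Qed.

Lemma ipn1 : ipn l2 1 = 1.
Proof. by rewrite /ipn l2E mulr1 Ex1 sqrtr1. Qed.

Lemma l2_congr f g f' g' : {ae mu, forall x, f x = f' x} ->
  {ae mu, forall x, g x = g' x} -> l2 f g = l2 f' g'.
Proof.
move=> ff gg; rewrite !l2E; apply: Ex_ae.
by apply: filterS2 ff gg => x; rewrite !bfunE => -> ->.
Qed.

Lemma ipn_eq0_ae f : ipn l2 f = 0 -> {ae mu, forall x, f x = 0}.
Proof. by move=> f0; apply: Ex_sqr_eq0; rewrite -l2E -ipn_sqr f0 expr0n. Qed.

End L2.

(** A common interface for the powers of [T1], of [T2] and of [T1 T2^-1], so that one development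
    serves all three. *)
Record mp_action (d : measure_display) (X : measurableType d) (R : realType)
    (mu : probability X R) := MpAction {
  act :> int -> X -> X ;
  act_measurable : forall n, measurable_fun [set: X] (act n) ;
  act_preserves : forall n A, measurable A -> mu (act n @^-1` A) = mu A ;
  act0 : forall x, act 0 x = x ;
  actD : forall m n x, act (m + n) x = act m (act n x) }.

Section koopman.
Context (d : measure_display) (X : measurableType d) (R : realType).
Variable mu : probability X R.
Local Notation V := (bfun X R).
Variable T : mp_action mu.
Implicit Types f g : V.

Fact koop_proof n f : (fun x => f (T n x)) \in @bmeas d X R.
Proof.
apply/asboolP; split.
  apply: measurableT_comp; first exact: measurable_bfun.
  exact: act_measurable.
by have [M fM] := bfun_bounded f; exists M => x.
Qed.

Definition koop n f : V := BFun (koop_proof n f).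

Lemma koopE n f x : koop n f x = f (T n x). Proof. by []. Qed.

Lemma koopD n f g : koop n (f + g) = koop n f + koop n g.
Proof. exact: bfun_ext. Qed.

Lemma koopB n f g : koop n (f - g) = koop n f - koop n g.
Proof. exact: bfun_ext. Qed.

Lemma koopM n f g : koop n (f * g) = koop n f * koop n g.
Proof. exact: bfun_ext. Qed.

Lemma koopZ n a f : koop n (a *: f) = a *: koop n f.
Proof. exact: bfun_ext. Qed.

Lemma koop_add m n f : koop (m + n) f = koop m (koop n f).
Proof. by apply: bfun_ext => x; rewrite !koopE addrC actD. Qed.

Lemma koop_bound n f (C : R) : (forall x, `|f x| <= C) ->
  forall x, `|koop n f x| <= C.
Proof. by move=> fC x; exact: fC. Qed.

Lemma ae_act n (P : X -> Prop) : {ae mu, forall x, P x} ->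
  {ae mu, forall x, P (T n x)}.
Proof.
move=> [N [mN N0 PN]]; exists (T n @^-1` N); split.
- by rewrite -[X in measurable X]setTI; exact: act_measurable.
- by rewrite act_preserves.
- by move=> x /= nPx; apply: PN.
Qed.

Lemma Ex_koop n f : Ex mu (koop n f) = Ex mu f.
Proof.
apply: EFin_inj; rewrite !EFin_Ex.
have mT := @act_measurable _ _ _ _ T n.
rewrite -[LHS](@integral_pushforward _ _ _ _ _ (T n) mT mu [set: X] (EFin \o f))//.
- by apply: eq_measure_integral => A mA _; exact: act_preserves.
- by apply/measurable_EFinP; exact: measurable_bfun.
- exact: (bfun_integrable mu (koop n f)).
Qed.

Lemma l2_koop n f g : l2 mu (koop n f) (koop n g) = l2 mu f g.
Proof. by rewrite !l2E -koopM Ex_koop. Qed.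

Lemma ipn_koop n f : ipn (l2 mu) (koop n f) = ipn (l2 mu) f.
Proof. by rewrite /ipn l2_koop. Qed.

Hypothesis Terg : ergodic mu (T 1).

(* The set of points along whose orbit [f] is constant and [<= c] is exactly
   invariant, which is what [ergodic] asks for. *)
Lemma ergodic_dichotomy f c : {ae mu, forall x, f (T 1 x) = f x} ->
  {ae mu, forall x, f x <= c} \/ {ae mu, forall x, c < f x}.
Proof.
move=> fT.
have fTn : {ae mu, forall x, forall k : nat,
    f (T k%:Z x) = f x /\ f (T (- k%:Z) x) = f x}.
  apply: (@ae_foralln _ _ _ mu (fun k x => f (T k%:Z x) = f x /\ f (T (- k%:Z) x) = f x)).
  move=> k; have H : {ae mu, forall x, f (T k%:Z x) = f x}.
    elim: k => [|k IH]; first by apply: aeW => x; rewrite act0.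
    move: (ae_act k%:Z fT) IH; apply: filterS2 => x h1 h2.
    by rewrite -h2 -h1 -actD; congr (f (T _ _)); lia.
  apply: filterS2 (ae_act (- k%:Z) H) H => x h1 h2; split => //.
  by rewrite -h1 -actD subrr act0.
(* Negative times are included: time [-1] is what brings [x] into [B] when [T 1 x] is in [B]. *)
pose B := [set x | (forall k : int, f (T k x) = f x) /\ f x <= c].
have BE : B = (\bigcap_(k : nat) [set x | f (T k%:Z x) - f x = 0]) `&`
   (\bigcap_(k : nat) [set x | f (T (- k%:Z) x) - f x = 0]) `&` [set x | f x <= c].
  apply/seteqP; split => x /=.
    by move=> [h1 h2]; do !split => //; move=> k _ /=; rewrite h1 subrr.
  move=> [[h1 h2] h3]; split => // -[] k; first exact/subr0_eq/(h1 k).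
  by rewrite NegzE; exact/subr0_eq/(h2 k.+1).
have mle (g h : V) : measurable [set x | g x <= h x :> R].
  rewrite -[X in measurable X]setTI.
  by apply: measurable_fun_le => //; exact: measurable_bfun.
have mz (g : V) : measurable [set x | g x = 0 :> R].
  rewrite (_ : mkset _ = [set x | g x <= (0 : V) x] `&` [set x | (0 : V) x <= g x]).
    exact: measurableI.
  apply/seteqP; split => x /=; first by move=> ->.
  by move=> [h1 h2]; apply/eqP; rewrite eq_le h1.
have mB : measurable B.
  rewrite BE; apply: measurableI; first apply: measurableI.
  - by apply: bigcap_measurable => // k _; exact: (mz (koop k%:Z f - f)).
  - by apply: bigcap_measurable => // k _; exact: (mz (koop (- k%:Z) f - f)).
  - rewrite (_ : mkset _ = [set x | f x <= (c *: (1 : V)) x]); first exact: mle.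
    by apply/seteqP; split => x; rewrite /mkset bfunZE bfun1E mulr1.
have TB : T 1 @^-1` B = B.
  apply/seteqP; split => x [/= h1 h2].
    have h0 : f x = f (T 1 x) by rewrite -(h1 (-1)) -actD addNr act0.
    split; last by rewrite h0.
    by move=> k; rewrite h0 -(h1 (k - 1)) -actD subrK.
  split; last by rewrite /= h1.
  by move=> k; rewrite -actD !h1.
case: (Terg mB TB) => muB; [right|left].
- have nB : {ae mu, forall x, ~ B x} by exists B; split => // x /= /contrapT.
  apply: filterS2 fTn nB => x h1 h2; rewrite ltNge; apply/negP => h3.
  by apply: h2; split => // -[k|k]; [have [] := h1 k|have [] := h1 k.+1].
- exists (~` B); split; first exact: measurableC.
    by rewrite probability_setC// muB subee.
  by move=> x /= h1 -[_ h2].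
Qed.

(** The dichotomy at the single threshold [c = Ex mu f] is enough: a function that stays on one side
    of its mean is almost everywhere equal to it. *)
Lemma ergodic_const f : {ae mu, forall x, f (T 1 x) = f x} ->
  {ae mu, forall x, f x = Ex mu f}.
Proof.
move=> fT; set c := Ex mu f.
have Ec : Ex mu (c *: (1 : V)) = c by rewrite ExZ Ex1 mulr1.
have [H|H] := ergodic_dichotomy c fT.
- have : {ae mu, forall x, (c *: (1 : V) - f) x = 0}.
    apply: Ex_ge0_eq0; last by rewrite ExB Ec subrr.
    by apply: filterS H => x; rewrite !bfunE mulr1 subr_ge0.
  by apply: filterS => x; rewrite !bfunE mulr1 => /subr0_eq.
- have : {ae mu, forall x, (f - c *: (1 : V)) x = 0}.
    apply: Ex_ge0_eq0; last by rewrite ExB Ec subrr.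
    by apply: filterS H => x /ltW; rewrite !bfunE mulr1 subr_ge0.
  by apply: filterS => x; rewrite !bfunE mulr1 => /subr0_eq.
Qed.

End koopman.

(** * Eigenfunctions *)

Section cis.
Context (d : measure_display) (X : measurableType d) (R : realType).
Variable mu : probability X R.
Local Notation V := (bfun X R).
Implicit Types f g : V.

(** The product of [f] by [exp (i t)]. As [l2p] is the real part of the Hermitian product, inner
    products only involve cosines of differences. *)
Definition cis (t : R) f : V * V := (cos t *: f, sin t *: f).

Lemma l2p_cis s t f g :
  l2p mu (cis s f) (cis t g) = cos (s - t) * l2 mu f g.
Proof. by rewrite l2pE /= !ipZl !ipZr cosB; ring. Qed.

Lemma ipn_cis t f : ipn (l2p mu) (cis t f) = ipn (l2 mu) f.
Proof. by rewrite /ipn l2p_cis subrr cos0 mul1r. Qed.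

Lemma avg_fst (u : int -> V * V) a n : (avg u a n).1 = avg (fun k => (u k).1) a n.
Proof.
rewrite /avg /=; congr (_ *: _).
by elim/big_rec2: _ => // i y1 y2 _ <-.
Qed.

Lemma avg_snd (u : int -> V * V) a n : (avg u a n).2 = avg (fun k => (u k).2) a n.
Proof.
rewrite /avg /=; congr (_ *: _).
by elim/big_rec2: _ => // i y1 y2 _ <-.
Qed.

Lemma avg_bound (u : int -> V) a n (C : R) : 0 <= C ->
  (forall k x, `|u k x| <= C) -> forall x, `|avg u a n x| <= C.
Proof.
move=> C0 uC x; rewrite /avg bfunZE bfun_sumE normrM ger0_norm ?invr_ge0//.
case: n => [|n]; first by rewrite invr0 mul0r.
rewrite ler_pdivrMl ?ltr0n//; apply: le_trans (ler_norm_sum _ _ _) _.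
apply: le_trans (ler_sum _ (fun i _ => uC _ _)) _.
by rewrite sumr_const card_ord -[_ *+ n.+1]mulr_natl.
Qed.

Lemma koop_avg (T : mp_action mu) m (u : int -> V) a n :
  koop T m (avg u a n) = avg (fun k => koop T m (u k)) a n.
Proof.
by apply: bfun_ext => x; rewrite koopE !bfunZE !bfun_sumE.
Qed.

End cis.

Section eigenfunctions.
Context (d : measure_display) (X : measurableType d) (R : realType).
Variable mu : probability X R.
Local Notation V := (bfun X R).
Implicit Types (T : mp_action mu) (f g r u v : V).

(* [u + iv] is an eigenfunction of [T] with eigenvalue [exp (it)]. *)
Definition rotates T (t : R) u v := {ae mu, forall x,
  u (T 1 x) = cos t * u x - sin t * v x /\
  v (T 1 x) = sin t * u x + cos t * v x}.

Lemma rotates_pow T t u v n : rotates T t u v -> {ae mu, forall x,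
  u (T n x) = cos (n%:~R * t) * u x - sin (n%:~R * t) * v x /\
  v (T n x) = sin (n%:~R * t) * u x + cos (n%:~R * t) * v x}.
Proof.
move=> rot; have H (k : nat) : {ae mu, forall x,
    u (T k%:Z x) = cos (k%:R * t) * u x - sin (k%:R * t) * v x /\
    v (T k%:Z x) = sin (k%:R * t) * u x + cos (k%:R * t) * v x}.
  elim: k => [|k IH].
    by apply: aeW => x; rewrite act0 mul0r sin0 cos0; split; ring.
  apply: filterS2 (ae_act T k%:Z rot) IH => x [h1 h2] [h3 h4].
  rewrite intS actD h1 h2 h3 h4 -natr1 mulrDl mul1r cosD sinD.
  by split; ring.
case: n => k; first exact: H.
(* The positive case is applied at [T (- k.+1) x], and the rotation is inverted by means of
   [c^2 + s^2 = 1]. *)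
rewrite NegzE; apply: filterS (ae_act T (- k.+1%:Z) (H k.+1)) => x [].
rewrite -!actD subrr !act0 mulrNz mulNr cosN sinN -[k.+1%:~R]/(k.+1%:R).
set c := cos _; set s := sin _ => -> ->.
have cs : c ^+ 2 + s ^+ 2 = 1 by rewrite cos2Dsin2.
set a := u _; set b := v _.
split; [rewrite -[LHS]mul1r|rewrite -[LHS]mul1r]; rewrite -cs; ring.
Qed.

(** A common eigenfunction [u + iv] of modulus one, whose two eigenvalues may differ. Asking for
    both at once yields one span that serves [T1] and [T2]. *)
Definition eigenpair T T' u v := [/\ exists t, rotates T t u v,
  exists t, rotates T' t u v & {ae mu, forall x, u x ^+ 2 + v x ^+ 2 = 1}].

Lemma eigenpairC T T' u v : eigenpair T T' u v -> eigenpair T' T u v.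
Proof. by case. Qed.

(** Testing against [u] also covers [v], because [(v, -u)] is again an eigenpair. *)
Definition eigen_small T T' (delta : R) r :=
  forall u v, eigenpair T T' u v -> `|l2 mu r u| <= delta.

Lemma eigen_smallC T T' delta r :
  eigen_small T T' delta r -> eigen_small T' T delta r.
Proof. by move=> H u v /eigenpairC; exact: H. Qed.

Lemma exists_angle (a b : R) : a ^+ 2 + b ^+ 2 = 1 ->
  exists t, cos t = a /\ sin t = b.
Proof.
move=> ab; have a1 : -1 <= a <= 1 by nra.
have b2 : 1 - a ^+ 2 = b ^+ 2 by rewrite -ab addrC addKr.
have [b0|b0] := lerP 0 b.
  exists (acos a); rewrite acosK// sin_acos// b2 sqrtr_sqr ger0_norm//.
exists (- acos a); rewrite cosN sinN acosK// sin_acos// b2 sqrtr_sqr.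
by rewrite ltr0_norm// opprK.
Qed.

(** The averages of this sequence tend to the projection of [r] to the eigenfunctions of eigenvalue
    [exp (- i t)]. *)
Definition twisted T (t : R) r (k : int) : V * V := cis (k%:~R * t) (koop T k r).

Lemma twisted_stationary T t r k m n :
  l2p mu (twisted T t r (m + k)) (twisted T t r (n + k)) =
  l2p mu (twisted T t r m) (twisted T t r n).
Proof.
rewrite !l2p_cis -!mulrBl -!intrB; congr (cos (_%:~R * _) * _).
  by rewrite opprD addrACA subrr addr0.
by rewrite !(addrC _ k) !koop_add l2_koop.
Qed.

Lemma ipn_twisted T t r k : ipn (l2p mu) (twisted T t r k) = ipn (l2 mu) r.
Proof. by rewrite ipn_cis ipn_koop. Qed.

(** The averages are Cauchy by the mean ergodic theorem and share a pointwise bound with [r], so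
    each component has a bounded limit. Other starting points are compared with the window at
    [0]. *)
Lemma twisted_limit T t r : exists P : V * V, forall e, 0 < e ->
  exists N, forall n a, (N <= n)%N ->
    ipn (l2p mu) (avg (twisted T t r) a n - P) <= e.
Proof.
have ME := @mean_ergodic _ _ (l2p mu) _ (twisted_stationary T t r).
have [C rC] := bfun_bounded r.
have C0 : 0 <= C by apply: le_trans (rC point).
have bnd1 n : forall x, `|(avg (twisted T t r) 0 n).1 x| <= C.
  move=> x; rewrite avg_fst; apply: avg_bound => // k y.
  rewrite bfunZE normrM -[leRHS]mul1r.
  by apply: ler_pM => //; [exact: cos_max|exact: rC].
have bnd2 n : forall x, `|(avg (twisted T t r) 0 n).2 x| <= C.
  move=> x; rewrite avg_snd; apply: avg_bound => // k y.
  rewrite bfunZE normrM -[leRHS]mul1r.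
  by apply: ler_pM => //; [exact: sin_max|exact: rC].
have [|P1 P1P] := @bfun_complete _ _ _ mu (fun n => (avg (twisted T t r) 0 n).1) C bnd1.
  move=> e e0; have se : 0 < Num.sqrt e by rewrite sqrtr_gt0.
  have [N NP] := ME _ se; exists N => m n Nm Nn.
  rewrite -l2E -[e]sqr_sqrtr ?(ltW e0)// -ipn_le ?(ltW se)//.
  exact: le_trans (ipn_fst mu _) (NP _ _ _ _ Nm Nn).
have [|P2 P2P] := @bfun_complete _ _ _ mu (fun n => (avg (twisted T t r) 0 n).2) C bnd2.
  move=> e e0; have se : 0 < Num.sqrt e by rewrite sqrtr_gt0.
  have [N NP] := ME _ se; exists N => m n Nm Nn.
  rewrite -l2E -[e]sqr_sqrtr ?(ltW e0)// -ipn_le ?(ltW se)//.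
  exact: le_trans (ipn_snd mu _) (NP _ _ _ _ Nm Nn).
exists (P1, P2) => e e0.
have e2 : 0 < e / 2 by rewrite divr_gt0.
have e3 : 0 < (e / 2) ^+ 2 / 2 by rewrite divr_gt0// exprn_gt0.
have [N1 N1P] := P1P _ e3; have [N2 N2P] := P2P _ e3; have [N3 N3P] := ME _ e2.
exists (maxn N1 (maxn N2 N3)) => n a; rewrite !geq_max => /and3P[n1 n2 n3].
apply: le_trans (ipn_split _ (avg (twisted T t r) 0 n) _ _) _.
rewrite [e]splitr; apply: lerD; first exact: N3P.
rewrite ipn_le ?(ltW e2)// l2pE !l2E /=.
have := N1P n n1; have := N2P n n2; lra.
Qed.

Section limit.
Variables (T : mp_action mu) (t : R) (r : V) (P : V * V).
Hypothesis limP : forall e, 0 < e -> exists N, forall n a, (N <= n)%N ->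
    ipn (l2p mu) (avg (twisted T t r) a n - P) <= e.

(** Composing an average with [T] moves its window by one step and multiplies it by [exp (- i t)];
    both windows have the same limit [P]. *)
Lemma limit_rotates : rotates T (- t) P.1 P.2.
Proof.
pose x := twisted T t r.
have step1 n : koop T 1 (avg x 0 n).1 =
    cos t *: (avg x 1 n).1 + sin t *: (avg x 1 n).2.
  rewrite !avg_fst !avg_snd koop_avg /avg !scalerA !(mulrC _ n%:R^-1) -!scalerA.
  rewrite -scalerDr; congr (_ *: _); rewrite !scaler_sumr -big_split /=.
  apply: eq_bigr => i _; rewrite koopZ -koop_add add0r !scalerA -scalerDl.
  congr (_ *: _).
  have -> : i%:~R * t = (1 + i%:Z)%:~R * t - t :> R by rewrite intrD; ring.
  by rewrite cosB; ring.
have step2 n : koop T 1 (avg x 0 n).2 =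
    cos t *: (avg x 1 n).2 - sin t *: (avg x 1 n).1.
  rewrite !avg_fst !avg_snd koop_avg /avg !scalerA !(mulrC _ n%:R^-1) -!scalerA.
  rewrite -scalerBr; congr (_ *: _); rewrite !scaler_sumr -sumrB /=.
  apply: eq_bigr => i _; rewrite koopZ -koop_add add0r !scalerA -scalerBl.
  congr (_ *: _).
  have -> : i%:~R * t = (1 + i%:Z)%:~R * t - t :> R by rewrite intrD; ring.
  by rewrite sinB; ring.
have small (y : V) : (forall e, 0 < e -> ipn (l2 mu) y <= 3 * e) ->
    {ae mu, forall x, y x = 0}.
  move=> H; apply: ipn_eq0_ae; apply/eqP; rewrite eq_le ipn_ge0 andbT.
  apply/ler_addgt0Pr => e e0; rewrite add0r.
  by apply: le_trans (H (e / 3) _) _; [rewrite divr_gt0|lra].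
have ccs := cos_max t.
have scs := sin_max t.
have H1 : {ae mu, forall x, (koop T 1 P.1 - (cos t *: P.1 + sin t *: P.2)) x = 0}.
  apply: small => e /limP[N NP].
  apply: le_trans (ipn_split _ (koop T 1 (avg x 0 N).1) _ _) _.
  rewrite -koopB ipn_koop step1 opprD addrACA -!scalerBr.
  have L1 := le_trans (ipn_fst mu _) (NP N 0 (leqnn _)).
  have L2 := le_trans (ipn_fst mu _) (NP N 1 (leqnn _)).
  have L3 := le_trans (ipn_snd mu _) (NP N 1 (leqnn _)).
  have : ipn (l2 mu) (cos t *: ((avg x 1 N).1 - P.1)) <= e.
    by rewrite ipnZ -[e]mul1r ler_pM.
  have : ipn (l2 mu) (sin t *: ((avg x 1 N).2 - P.2)) <= e.
    by rewrite ipnZ -[e]mul1r ler_pM.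
  have := ipnD (l2 mu) (cos t *: ((avg x 1 N).1 - P.1)) (sin t *: ((avg x 1 N).2 - P.2)).
  rewrite ipnBC in L1; move: L1 L2 L3 => /=; lra.
have H2 : {ae mu, forall x, (koop T 1 P.2 - (cos t *: P.2 - sin t *: P.1)) x = 0}.
  apply: small => e /limP[N NP].
  apply: le_trans (ipn_split _ (koop T 1 (avg x 0 N).2) _ _) _.
  rewrite -koopB ipn_koop step2 opprD addrACA -opprD -!scalerBr.
  have L1 := le_trans (ipn_snd mu _) (NP N 0 (leqnn _)).
  have L2 := le_trans (ipn_fst mu _) (NP N 1 (leqnn _)).
  have L3 := le_trans (ipn_snd mu _) (NP N 1 (leqnn _)).
  have : ipn (l2 mu) (cos t *: ((avg x 1 N).2 - P.2)) <= e.
    by rewrite ipnZ -[e]mul1r ler_pM.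
  have : ipn (l2 mu) (sin t *: ((avg x 1 N).1 - P.1)) <= e.
    by rewrite ipnZ -[e]mul1r ler_pM.
  have := ipnB (l2 mu) (cos t *: ((avg x 1 N).2 - P.2)) (sin t *: ((avg x 1 N).1 - P.1)).
  rewrite ipnBC in L1; move: L1 L2 L3 => /=; lra.
apply: filterS2 H1 H2 => y; rewrite !bfunE !koopE cosN sinN => /subr0_eq -> /subr0_eq ->.
by split; ring.
Qed.

(** [P] behaves as the orthogonal projection of [r]: by [limit_rotates] every term of the averages
    has the same inner product with [P], and the averages tend to [P]. *)
Lemma limit_ip : l2 mu r P.1 = ipn (l2p mu) P ^+ 2.
Proof.
have xk k : l2p mu (twisted T t r k) P = l2 mu r P.1.
  rewrite l2pE /= !ipZl -!ipZr -ipDr -(l2_koop T k r).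
  apply: l2_congr; first exact: aeW.
  apply: filterS (rotates_pow k limit_rotates) => x [+ _].
  by rewrite koopE => ->; rewrite !bfunE mulrN cosN sinN; ring.
have an n : (0 < n)%N -> l2p mu (avg (twisted T t r) 0 n) P = l2 mu r P.1.
  move=> n0; rewrite /avg ipZl ip_suml (eq_bigr (fun=> l2 mu r P.1))//.
  rewrite sumr_const card_ord -[l2 mu r P.1 *+ n]mulr_natl mulrA mulVf ?mul1r//.
  by rewrite pnatr_eq0 -lt0n.
apply/eqP; rewrite -subr_eq0 -normr_le0; apply/ler_addgt0Pr => e e0; rewrite add0r.
have e1 : 0 < e / (ipn (l2p mu) P + 1) by rewrite divr_gt0// ltr_wpDl.
have [N NP] := limP e1.
rewrite -(an N.+1)// ipn_sqr -ipBl; apply: le_trans (ip_cs _ _ _) _.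
apply: (@le_trans _ _ (e / (ipn (l2p mu) P + 1) * (ipn (l2p mu) P + 1))).
  by apply: ler_pM => //; [exact: NP|rewrite lerDl].
by rewrite divfK// gt_eqF// ltr_wpDl.
Qed.

End limit.

(** * Common eigenfunctions of commuting actions *)

Section joint.
Variables T T' : mp_action mu.
Hypothesis TT' : forall x, T 1 (T' 1 x) = T' 1 (T 1 x).
Hypothesis Terg : ergodic mu (T 1).

(* By ergodicity [T' P / P] is a constant of modulus [1] for every
   [T]-eigenfunction [P]. *)
Lemma rotates_joint t u v (c : R) : 0 < c -> rotates T t u v ->
  {ae mu, forall x, u x ^+ 2 + v x ^+ 2 = c ^+ 2} ->
  eigenpair T T' (c^-1 *: u) (c^-1 *: v).
Proof.
move=> c0 rot uvc.
have cn0 : c != 0 by rewrite gt_eqF.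
(* [w1 + i w2] is [T' P] times the conjugate of [P = u + iv]. As [T] and [T'] commute, both factors
   turn by the same angle under [T], so the product is invariant. *)
pose w1 := koop T' 1 u * u + koop T' 1 v * v.
pose w2 := koop T' 1 v * u - koop T' 1 u * v.
have cs : cos t ^+ 2 + sin t ^+ 2 = 1 by rewrite cos2Dsin2.
have w1c : {ae mu, forall x, w1 x = Ex mu w1}.
  apply: ergodic_const Terg _ _.
  apply: filterS2 rot (ae_act T' 1 rot) => x [h1 h2] [h3 h4].
  rewrite /w1 !bfunE !koopE -TT' h1 h2 h3 h4 -[RHS]mul1r -cs; ring.
have w2c : {ae mu, forall x, w2 x = Ex mu w2}.
  apply: ergodic_const Terg _ _.
  apply: filterS2 rot (ae_act T' 1 rot) => x [h1 h2] [h3 h4].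
  rewrite /w2 !bfunE !koopE -TT' h1 h2 h3 h4 -[RHS]mul1r -cs; ring.
set c1 := Ex mu w1 in w1c; set c2 := Ex mu w2 in w2c.
have [s [ss1 ss2]] : exists s, cos s = c1 / c ^+ 2 /\ sin s = c2 / c ^+ 2.
  apply: exists_angle.
  have H : {ae mu, forall x, c1 ^+ 2 + c2 ^+ 2 = c ^+ 2 * c ^+ 2}.
    near=> x.
    have <- : w1 x = c1 by near: x.
    have <- : w2 x = c2 by near: x.
    have <- : u x ^+ 2 + v x ^+ 2 = c ^+ 2 by near: x.
    have : u (T' 1 x) ^+ 2 + v (T' 1 x) ^+ 2 = u x ^+ 2 + v x ^+ 2.
      have -> : u x ^+ 2 + v x ^+ 2 = c ^+ 2 by near: x.
      by near: x; exact: ae_act uvc.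
    rewrite /w1 /w2 !bfunE !koopE => h; rewrite -{1}h; ring.
  (* [H] is about constants only; a set of full measure contains a point, so the equation holds
     outright. *)
  have mu0 : (0 < mu [set: X])%E by rewrite probability_setT.
  have [_ h] := @filter_ex _ _ (ae_properfilter_algebraOfSetsType mu0) _ H.
  rewrite !expr_div_n -mulrDl h -expr2 divff//.
  by rewrite !expf_neq0.
split.
- exists t; apply: filterS rot => x [h1 h2].
  by rewrite !bfunZE h1 h2; split; ring.
- exists s; near=> x.
  have h1 : w1 x = c1 by near: x.
  have h2 : w2 x = c2 by near: x.
  have h3 : u x ^+ 2 + v x ^+ 2 = c ^+ 2 by near: x.
  have c20 : c ^+ 2 != 0 by rewrite expf_neq0.
  rewrite !bfunZE ss1 ss2 -h1 -h2 /w1 /w2 !bfunE !koopE.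
  split; apply: (mulIf c20); rewrite -{1}h3; field; exact: cn0.
- apply: filterS uvc => x h; rewrite !bfunZE !exprMn -mulrDr h exprVn mulVf//.
  by rewrite expf_neq0.
Unshelve. all: by end_near. Qed.

(** If the limit [P] is not zero, ergodicity makes its modulus constant, equal to its norm. Then [P]
    divided by its norm is an eigenpair whose first component has inner product with [r] equal to
    the norm of [P], which is therefore at most [delta]. *)
Lemma eigen_small_avg delta r t : 0 <= delta -> eigen_small T T' delta r ->
  forall e, 0 < e -> exists N, forall n a, (N <= n)%N ->
    ipn (l2p mu) (avg (twisted T t r) a n) <= delta + e.
Proof.
move=> d0 rsmall e e0; have [P limP] := twisted_limit T t r.
suff Pd : ipn (l2p mu) P <= delta.
  have [N NP] := limP _ e0; exists N => n a /(NP _ a) h.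
  by apply: le_trans (ipn_leD _ _ P) _; exact: lerD.
have rot := limit_rotates limP.
have [->//|c0] := eqVneq (ipn (l2p mu) P) 0.
have {}c0 : 0 < ipn (l2p mu) P by rewrite lt_def c0 ipn_ge0.
have mod_const : {ae mu, forall x,
    (P.1 * P.1 + P.2 * P.2) x = Ex mu (P.1 * P.1 + P.2 * P.2)}.
  apply: ergodic_const Terg _ _; apply: filterS rot => x [h1 h2].
  rewrite !bfunE h1 h2 cosN sinN -[RHS]mul1r -(cos2Dsin2 t); ring.
have {}mod_const : {ae mu, forall x,
    P.1 x ^+ 2 + P.2 x ^+ 2 = ipn (l2p mu) P ^+ 2}.
  apply: filterS mod_const => x; rewrite ipn_sqr l2pE !l2E -ExD => <-.
  by rewrite !bfunE !expr2.
have := rsmall _ _ (rotates_joint c0 rot mod_const).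
rewrite ipZr (limit_ip limP) expr2 mulKf ?gt_eqF//.
by move=> h; apply: le_trans h; exact: ler_norm.
Qed.

End joint.

End eigenfunctions.

(** * Wiener's lemma *)

Section trigonometric_sums.
Context (R : realType).
Implicit Types (x t : R).

Lemma cos_sin_2pi_nat (j : nat) :
  cos (j%:R * (2 * pi)) = 1 :> R /\ sin (j%:R * (2 * pi)) = 0 :> R.
Proof.
elim: j => [|j [c s]]; first by rewrite mul0r cos0 sin0.
rewrite -natr1 mulrDl mul1r cosD sinD c s.
have -> : 2 * pi = pi + pi :> R by ring.
by rewrite cosD sinD cospi sinpi; split; ring.
Qed.

(** The Dirichlet kernel: [2 sin (x / 2) cos (k x)] is the difference
    [sin (k x + x / 2) - sin (k x - x / 2)], which telescopes. *)
Lemma sum_cos_sin x n : 2 * sin (x / 2) * (\sum_(k < n) cos (k%:R * x)) =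
  sin (n%:R * x - x / 2) + sin (x / 2).
Proof.
elim: n => [|n IH]; first by rewrite big_ord0 mulr0 mul0r sub0r sinN addNr.
rewrite big_ord_recr /= mulrDr IH -[n.+1%:R]natr1.
have -> : (n%:R + 1) * x - x / 2 = n%:R * x + x / 2 by field.
by rewrite sinB sinD; ring.
Qed.

Lemma sum_cos_grid (n : nat) (j : int) : (`|j| < n)%N ->
  \sum_(k < n) cos (k%:R * (j%:~R * (2 * pi / n%:R))) = if j == 0 then n%:R else 0 :> R.
Proof.
move=> jn; have [->|j0] := eqVneq j 0.
  by rewrite (eq_bigr (fun=> 1)) ?sumr_const ?card_ord// => k _; rewrite mul0r mulr0 cos0.
have -> : \sum_(k < n) cos (k%:R * (j%:~R * (2 * pi / n%:R))) =
    \sum_(k < n) cos (k%:R * (`|j|%N%:R * (2 * pi / n%:R))) :> R.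
  apply: eq_bigr => k _; case: j {jn j0} => j //; rewrite NegzE.
  by rewrite !mulrNz !(mulNr, mulrN) cosN abszN.
have j1 : (0 < `|j|)%N by rewrite absz_gt0.
move: (`|j|%N) j1 jn => {j0}j j0 jn.
set x := j%:R * _.
have nR : 0 < n%:R :> R by rewrite ltr0n; apply: leq_ltn_trans jn.
(* [x / 2 = pi j / n] lies strictly between [0] and [pi], so this factor can be cancelled. *)
have sx : 0 < sin (x / 2).
  apply: sin_gt0_pi; apply/andP; split.
    by rewrite !(mulr_gt0, divr_gt0) ?ltr0n ?pi_gt0 ?invr_gt0.
  have -> : x / 2 = j%:R / n%:R * pi by rewrite /x; field; rewrite gt_eqF.
  by rewrite gtr_pMl ?pi_gt0// ltr_pdivrMr// mul1r ltr_nat.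
have := sum_cos_sin x n.
have -> : n%:R * x = j%:R * (2 * pi) by rewrite /x; field; rewrite gt_eqF.
rewrite sinB; have [-> ->] := cos_sin_2pi_nat j.
rewrite mul0r mul1r sub0r addNr => /eqP; rewrite mulf_eq0 => /orP[|/eqP//].
by rewrite mulf_eq0 pnatr_eq0 /= gt_eqF.
Qed.

Lemma cosMcos x t : cos x * cos t = (cos (x - t) + cos (x + t)) / 2.
Proof. by rewrite cosB cosD; field. Qed.

End trigonometric_sums.

(** The pairs [(h + j, h' + j)] with [j < m] all have the same difference; the range is doubled so
    that they fit. *)
Lemma card_shifted_pairs (m : nat) (h h' : 'I_m) :
  (m <= \sum_(g < m + m) \sum_(g' < m + m) (h + g' == h' + g)%N)%N.
Proof.
rewrite pair_big /= (eq_bigr (fun p : 'I_(m + m) * 'I_(m + m) =>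
  if (h + p.2 == h' + p.1)%N then 1%N else 0%N)); last by move=> p _; case: eqP.
rewrite -big_mkcond sum1dep_card /=.
have lt2 (i j : 'I_m) : (i + j < m + m)%N by rewrite -addSn leq_add// ltnW.
pose f j := (Ordinal (lt2 h j), Ordinal (lt2 h' j)).
have finj : injective f by move=> i j [/addnI ij _]; exact: val_inj.
rewrite -{1}(card_ord m) -(card_imset _ finj) subset_leq_card//.
by apply/fintype.subsetP => _ /imsetP[j _ ->]; rewrite inE /=; apply/eqP; lia.
Qed.

Section correlations.
Context (d : measure_display) (X : measurableType d) (R : realType).
Variables (mu : probability X R) (T : mp_action mu) (r : bfun X R).

Definition corr (h h' : int) : R := l2 mu (koop T h r) (koop T h' r).

Lemma corrC h h' : corr h h' = corr h' h.
Proof. exact: ipC. Qed.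

Lemma corr_shift h h' g g' : h - h' = g - g' -> corr h h' = corr g g'.
Proof.
move=> hg; rewrite /corr -(l2_koop T (h - g) (koop T g r)) -!koop_add.
by rewrite subrK; congr (l2 mu _ (koop T _ r)); lia.
Qed.

Lemma corr_diag h : corr h h = ipn (l2 mu) r ^+ 2.
Proof. by rewrite /corr l2_koop ipn_sqr. Qed.

(** * Parseval's identity on a finite grid of frequencies *)

Section grid.
Variable m : nat.
Hypothesis m0 : (0 < m)%N.
Local Notation N := (m + m)%N.
Local Notation n := (N + N)%N.
(** Differences of indices lie in [(-N, N)], and sums of two such in [(-n, n)]: with [n = 2 N] grid
    points the discrete orthogonality relations apply to all of them. *)
Let theta : R := 2 * pi / n%:R.

Let q (t : R) : R := ipn (l2p mu) (\sum_(h < N) twisted T t r h%:Z) ^+ 2.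

Let qE (k : nat) : q (k%:R * theta) =
  \sum_(p : 'I_N * 'I_N) cos (k%:R * ((p.1%:Z - p.2%:Z)%:~R * theta)) * corr p.1 p.2.
Proof.
rewrite /q ipn_sqr ip_suml -(pair_bigA _ (fun h h' : 'I_N =>
  cos (k%:R * ((h%:Z - h'%:Z)%:~R * theta)) * corr h h')) /=.
apply: eq_bigr => h _; rewrite ip_sumr; apply: eq_bigr => h' _.
by rewrite l2p_cis; congr (cos _ * _); rewrite intrB; ring.
Qed.

Let grid_sum : \sum_(k < n) q (k%:R * theta) = n%:R * N%:R * ipn (l2 mu) r ^+ 2.
Proof.
under eq_bigr do rewrite qE.
rewrite exchange_big /=.
rewrite (eq_bigr (fun p : 'I_N * 'I_N =>
   (if p.1 == p.2 then n%:R else 0) * corr p.1 p.2)); last first.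
  move=> p _; rewrite -mulr_suml sum_cos_grid; last first.
    by have := ltn_ord p.1; have := ltn_ord p.2; lia.
  by rewrite subr_eq0 eqz_nat val_eqE.
rewrite -(pair_bigA _ (fun h h' : 'I_N => (if h == h' then n%:R else 0) * corr h h')) /=.
rewrite (eq_bigr (fun=> n%:R * ipn (l2 mu) r ^+ 2)).
  by rewrite sumr_const card_ord -[_ *+ N]mulr_natr; ring.
move=> h _; rewrite (bigD1 h)//= eqxx corr_diag big1 ?addr0// => h' hh.
by rewrite eq_sym (negbTE hh) mul0r.
Qed.

(** In the expanded square, equal differences contribute [n / 2] times a squared correlation,
    opposite ones a nonnegative amount, all others nothing. A difference of two indices below [m]
    occurs at least [m] times. *)
Let grid_sum_sqr : n%:R / 2 * m%:R * (\sum_(h < m) \sum_(h' < m) corr h h' ^+ 2) <=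
  \sum_(k < n) q (k%:R * theta) ^+ 2.
Proof.
pose dif (p : 'I_N * 'I_N) := p.1%:Z - p.2%:Z.
pose co (p : 'I_N * 'I_N) := corr p.1 p.2.
have difN p : (`|dif p| < N)%N.
  by rewrite /dif; have := ltn_ord p.1; have := ltn_ord p.2; lia.
have nR : 0 <= n%:R / 2 :> R by rewrite divr_ge0.
apply: (@le_trans _ _ (\sum_p \sum_p' n%:R / 2 * (dif p == dif p')%:R * co p ^+ 2)).
  rewrite (eq_bigr (fun p => n%:R / 2 * (\sum_p' (dif p == dif p')%:R) *
    co p ^+ 2)); last first.
    by move=> p _; rewrite -mulr_suml -mulr_sumr.
  have F0 p : 0 <= n%:R / 2 * (\sum_p' (dif p == dif p')%:R) * co p ^+ 2.
    by rewrite mulr_ge0 ?sqr_ge0// mulr_ge0// sumr_ge0.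
  rewrite -(pair_bigA _ (fun h h' : 'I_N => n%:R / 2 *
     (\sum_p' (dif (h, h') == dif p')%:R) * co (h, h') ^+ 2)) /=.
  (* Only indices in the first half of [[0, N)] are kept, where [card_shifted_pairs] applies. *)
  rewrite big_split_ord /= -[leLHS]addr0; apply: lerD; last first.
    by apply: sumr_ge0 => h _; apply: sumr_ge0 => h' _; exact: (F0 (_, _)).
  rewrite mulr_sumr; apply: ler_sum => h _.
  rewrite big_split_ord /= -[leLHS]addr0; apply: lerD; last first.
    by apply: sumr_ge0 => h' _; exact: (F0 (_, _)).
  rewrite mulr_sumr; apply: ler_sum => h' _.
  rewrite ler_wpM2r ?sqr_ge0// ler_wpM2l//.
  rewrite -natr_sum ler_nat; apply: leq_trans (card_shifted_pairs h h') _.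
  rewrite pair_big /= leq_sum// => p _.
  by case: eqP => // e; rewrite /dif /=; case: eqP => //; lia.
have -> : \sum_(k < n) q (k%:R * theta) ^+ 2 = \sum_p \sum_p' co p * co p' *
   \sum_(k < n) cos (k%:R * ((dif p)%:~R * theta)) * cos (k%:R * ((dif p')%:~R * theta)).
  under eq_bigr do rewrite qE expr2 big_distrlr.
  rewrite exchange_big; apply: eq_bigr => p _; rewrite exchange_big.
  apply: eq_bigr => p' _; rewrite mulr_sumr; apply: eq_bigr => k _.
  by rewrite [LHS]mulrACA mulrC.
apply: ler_sum => p _; apply: ler_sum => p' _.
rewrite (eq_bigr (fun k : 'I_n => (cos (k%:R * ((dif p - dif p')%:~R * theta)) +
   cos (k%:R * ((dif p + dif p')%:~R * theta))) / 2)); last first.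
  move=> k _; rewrite cosMcos; congr ((cos _ + cos _) / 2).
    by rewrite intrB; ring.
  by rewrite intrD; ring.
rewrite -mulr_suml big_split /= !sum_cos_grid; last 2 first.
- by have := difN p; have := difN p'; lia.
- by have := difN p; have := difN p'; lia.
have co1 : dif p = dif p' -> co p' = co p by move=> ?; exact/esym/corr_shift.
have co2 : dif p = - dif p' -> co p' = co p.
  by move=> e; rewrite /co corrC; apply: corr_shift; move: e; rewrite /dif; lia.
rewrite subr_eq0 addr_eq0; have := mulr_ge0 nR (sqr_ge0 (co p)).
by case: eqP => [/co1 e1|_]; case: eqP => [/co2 e2|_]; rewrite ?e1 ?e2 /=; lra.
Qed.

(** If [q] were at most [c m^2] on the whole grid, the sum of [q^2] would be at most [c m^2] times
    the sum of [q], hence at most [8 c n m^3], against [grid_sum_sqr]. The factor [4] in the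
    conclusion is due to windows of length [N = 2 m]. *)
Lemma exists_large_frequency c : 0 <= c -> ipn (l2 mu) r <= 2 ->
  16 * c * m%:R ^+ 2 < \sum_(h < m) \sum_(h' < m) corr h h' ^+ 2 ->
  exists2 t, 0 <= t <= 2 * pi &
    c < ipn (l2p mu) (avg (twisted T t r) 0 N) ^+ 2 * 4.
Proof.
move=> c0 r2 big_corr; have nR : 0 < n%:R :> R by rewrite ltr0n; lia.
have mR : 0 < m%:R :> R by rewrite ltr0n.
have th0 : 0 < theta by rewrite divr_gt0// mulr_gt0// pi_gt0.
apply: contrapT => no.
have qle (k : 'I_n) : q (k%:R * theta) <= c * m%:R ^+ 2.
  rewrite leNgt; apply/negP => lt; apply: no; exists (k%:R * theta).
    rewrite mulr_ge0 ?(ltW th0)//= /theta mulrCA ler_piMr//.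
      by rewrite mulr_ge0// pi_ge0.
    by rewrite ler_pdivrMr// mul1r ler_nat ltnW.
  rewrite /avg ipnZ exprMn real_normK ?num_real// -/(q _).
  have -> : N%:R = 2 * m%:R :> R by rewrite natrD mulr_natl mulr2n.
  have -> : (2 * m%:R)^-1 ^+ 2 * q (k%:R * theta) * 4 = q (k%:R * theta) / m%:R ^+ 2.
    by field; rewrite gt_eqF.
  by rewrite ltr_pdivlMr// exprn_gt0.
have q0 (k : 'I_n) : 0 <= q (k%:R * theta) by exact: sqr_ge0.
have : \sum_(k < n) q (k%:R * theta) ^+ 2 <=
    c * m%:R ^+ 2 * (n%:R * N%:R * ipn (l2 mu) r ^+ 2).
  rewrite -grid_sum mulr_sumr; apply: ler_sum => k _.
  by rewrite expr2 ler_wpM2r.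
move=> /(le_trans grid_sum_sqr); apply/negP; rewrite -ltNge.
have r4 : ipn (l2 mu) r ^+ 2 <= 4.
  by rewrite (_ : 4 = 2 ^+ 2); [rewrite ler_pXn2r// nnegrE|ring].
apply: (@le_lt_trans _ _ (c * m%:R ^+ 2 * (n%:R * N%:R * 4))).
  by rewrite ler_wpM2l ?mulr_ge0 ?sqr_ge0// ler_wpM2l ?mulr_ge0.
have -> : c * m%:R ^+ 2 * (n%:R * N%:R * 4) = n%:R / 2 * m%:R * (16 * c * m%:R ^+ 2) :> R.
  by rewrite [N%:R]natrD; field.
by rewrite ltr_pM2l// mulr_gt0// divr_gt0.
Qed.

End grid.

Lemma continuous_ipn_avg n : continuous (fun t =>
  ipn (l2p mu) (avg (twisted T t r) 0 n) ^+ 2).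
Proof.
rewrite (_ : (fun t => _) = (fun t => n%:R^-1 * (n%:R^-1 *
    \sum_(i < n) \sum_(j < n) cos (i%:R * t - j%:R * t) * corr i j))).
  move=> t; apply: cvgMl_tmp; apply: cvgMl_tmp.
  apply: cvg_big => [|i _]; first exact: add_continuous.
  apply: cvg_big => [|j _]; first exact: add_continuous.
  apply: cvgMr_tmp.
  apply: continuous_cvg; first exact: continuous_cos.
  by apply: cvgB; apply: cvgMl_tmp; exact: cvg_id.
apply/funext => t; rewrite ipn_sqr /avg ipZl ipZr ip_suml; congr (_ * (_ * _)).
apply: eq_bigr => i _; rewrite ip_sumr; apply: eq_bigr => j _.
by rewrite l2p_cis.
Qed.

(* Wiener's lemma, quantitatively: by Parseval on a grid of frequencies, large
   correlations force some twisted average to be large at every scale, and a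
   limit of the frequencies would violate the assumption. *)
Lemma correlation_decay delta : 0 < delta -> ipn (l2 mu) r <= 2 ->
  (forall t e, 0 < e -> exists N, forall n a, (N <= n)%N ->
     ipn (l2p mu) (avg (twisted T t r) a n) <= delta + e) ->
  exists2 m, (0 < m)%N &
    \sum_(h < m) \sum_(h' < m) corr h h' ^+ 2 <= (32 * delta) ^+ 2 * m%:R ^+ 2.
Proof.
move=> d0 r2 small; apply: contrapT => no.
have /choice [t tP] : forall m : nat, exists t, 0 <= t <= 2 * pi /\
    4 * delta < ipn (l2p mu) (avg (twisted T t r) 0 (m.+1 + m.+1)).
  (* For [c = 64 delta^2], [16 c] is [(32 delta)^2] and the average that is found exceeds
     [4 delta]. *)
  move=> m; have [//||//||t t2 tP] := @exists_large_frequency m.+1 _ (64 * delta ^+ 2).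
  - by rewrite mulr_ge0// sqr_ge0.
  - rewrite ltNge; apply/negP => le; apply: no; exists m.+1 => //.
    by apply: le_trans le _; rewrite le_eqVlt; apply/orP; left; apply/eqP; ring.
  exists t; split => //; rewrite ltNge; apply/negP => le.
  move: tP; apply/negP; rewrite -leNgt.
  have := ipn_ge0 (l2p mu) (avg (twisted T t r) 0 (m.+1 + m.+1)); nra.
(* At a cluster point [t0] of the frequencies, averages of length [M.+1] are at most [2 delta],
   hence below [3 delta] near [t0]. Longer averages at such a frequency are means of these up to an
   edge effect of [delta], so they cannot exceed [4 delta]. *)
have [|t0 [_ clt0]] := @segment_compact R 0 (2 * pi) (t m @[m --> \oo]) _.
  by exists 0%N => // m _ /=; rewrite in_itv /=; have [] := tP m.
have [M MP] := small t0 delta d0.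
have near_t0 : \forall s \near t0,
    ipn (l2p mu) (avg (twisted T s r) 0 M.+1) ^+ 2 < (3 * delta) ^+ 2.
  have := @continuous_ipn_avg M.+1 t0; move/cvgr_lt; apply.
  rewrite ltr_pXn2r// ?nnegrE//; last by rewrite mulr_ge0// ltW.
  by apply: le_lt_trans (MP M.+1 0 (leqnSn M)) _; lra.
have [N NP] := div_nat_le (2 * M.+1%:R * 2) d0.
have [_ [[m Nm <-] /= tm]] := clt0 [set t m | m in [set m | (N <= m)%N]] _
  (ltac:(by exists N => // m Nm; exists m)) near_t0.
have [_] := tP m; apply/negP; rewrite -leNgt.
have xC k : ipn (l2p mu) (twisted T (t m) r k) <= 2 by rewrite ipn_twisted.
apply: le_trans (ipn_leD _ _
  (avg (fun k => avg (twisted T (t m) r) k M.+1) 0 (m.+1 + m.+1))) _.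
have h1 := avg_avg xC 0 (m.+1 + m.+1) (ltn0Sn M).
have h2 : 2 * M.+1%:R * 2 / (m.+1 + m.+1)%N%:R <= delta by apply: NP; move: Nm => /=; lia.
have h3 : ipn (l2p mu) (avg (fun k => avg (twisted T (t m) r) k M.+1) 0
    (m.+1 + m.+1)) <= 3 * delta.
  apply: ipn_avg => [|k]; first by rewrite mulr_ge0// ltW.
  rewrite (stationary_avg_ipn (twisted_stationary T (t m) r)).
  by rewrite -(@ler_pXn2r _ 2)// ?nnegrE ?mulr_ge0// ltW.
lra.
Qed.

End correlations.

(** * Joint averages *)

Lemma eventually_forall (I : finType) (P : I -> nat -> Prop) :
  (forall i, exists N, forall n, (N <= n)%N -> P i n) ->
  exists N, forall n, (N <= n)%N -> forall i, P i n.
Proof.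
move=> /choice[f fP]; exists (\max_i f i) => n Nn i; apply: fP.
by apply: leq_trans Nn; exact: leq_bigmax.
Qed.

Lemma ip_avgl (R : realType) (V : lmodType R) (B : semi_ip V) (u : int -> V) a n y :
  B (avg u a n) y = avg (fun k => B (u k) y : R^o) a n.
Proof. by rewrite /avg ipZl ip_suml. Qed.

Section joint_averages.
Context (d : measure_display) (X : measurableType d) (R : realType).
Variables (mu : probability X R) (T1 T2 S : mp_action mu).
Hypothesis T1S : forall n x, T1 n x = S n (T2 n x).
Hypothesis Serg : ergodic mu (S 1).
Local Notation V := (bfun X R).
Implicit Types f g r : V.

(** The averages of [S^k f] tend to an invariant function, hence to a constant, which must be the
    mean of [f]. *)
Lemma ergodic_average f g e : 0 < e -> exists N, forall n a, (N <= n)%N ->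
  `|avg (fun k => l2 mu (koop S k f) g : R^o) a n - Ex mu f * Ex mu g| <= e.
Proof.
move=> e0; have [P limP] := twisted_limit S 0 f.
have tw a n : (avg (twisted S 0 f) a n).1 = avg (fun k => koop S k f) a n.
  rewrite avg_fst; congr (_ *: _); apply: eq_bigr => i _.
  by rewrite /twisted /= mulr0 cos0 scale1r.
have P1c : {ae mu, forall x, P.1 x = Ex mu P.1}.
  apply: ergodic_const Serg _ _; apply: filterS (limit_rotates limP) => x [-> _].
  by rewrite oppr0 cos0 sin0; ring.
have lim1 e1 : 0 < e1 -> exists N, forall n a, (N <= n)%N ->
    ipn (l2 mu) (avg (fun k => koop S k f) a n - P.1) <= e1.
  move=> /limP[N NP]; exists N => n a /(NP n a); apply: le_trans.
  by rewrite -tw; exact: (ipn_fst mu (avg _ _ _ - P)).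
have lim2 h e1 : 0 < e1 -> exists N, forall n a, (N <= n)%N ->
    `|avg (fun k => l2 mu (koop S k f) h : R^o) a n - l2 mu P.1 h| <= e1.
  move=> e10; have e2 : 0 < e1 / (ipn (l2 mu) h + 1) by rewrite divr_gt0// ltr_wpDl.
  have [N NP] := lim1 _ e2; exists N => n a /(NP n a) le.
  rewrite -ip_avgl -ipBl; apply: le_trans (ip_cs _ _ _) _.
  apply: (@le_trans _ _ (e1 / (ipn (l2 mu) h + 1) * (ipn (l2 mu) h + 1))).
    by apply: ler_pM => //; rewrite lerDl.
  by rewrite divfK// gt_eqF// ltr_wpDl.
have EP : Ex mu P.1 = Ex mu f.
  apply/eqP; rewrite -subr_eq0 -normr_le0; apply/ler_addgt0Pr => e1 e10; rewrite add0r.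
  have [N NP] := lim2 1 _ e10.
  rewrite distrC; move: (NP N.+1 0 (leqnSn N)).
  rewrite /avg (eq_bigr (fun=> Ex mu f)); last by move=> i _; rewrite -Ex_l2 Ex_koop.
  rewrite sumr_const card_ord -[Ex mu f *+ _]mulr_natl -Ex_l2.
  by rewrite -[_ *: _]/(_ * _) mulKf ?pnatr_eq0.
have <- : l2 mu P.1 g = Ex mu f * Ex mu g.
  rewrite -EP -ExZ !l2E; apply: Ex_ae; apply: filterS P1c => x.
  by rewrite !bfunE => {1}->.
exact: lim2.
Qed.

Lemma joint_average f g e : 0 < e -> exists N, forall n a, (N <= n)%N ->
  `|avg (fun k => l2 mu (koop T1 k f) (koop T2 k g) : R^o) a n - Ex mu f * Ex mu g| <= e.
Proof.
move=> /(ergodic_average f g) [N NP]; exists N => n a /(NP n a).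
rewrite (_ : (fun k => _) = (fun k => l2 mu (koop T1 k f) (koop T2 k g) : R^o))//.
apply/funext => k; rewrite -(l2_koop T2 k (koop S k f)); congr (l2 mu _ _).
by apply: bfun_ext => x; rewrite !koopE T1S.
Qed.

Definition twisted2 t r f (k : int) : V * V :=
  cis (k%:~R * t) (koop T1 k r * koop T2 k f).

(** The twist leaves a factor that depends on [h - h'] but not on [k]; the rest is of the form
    treated by [joint_average]. *)
Lemma twisted2_ip t r f (k : int) (h h' : nat) :
  l2p mu (twisted2 t r f (k + h%:Z)) (twisted2 t r f (k + h'%:Z)) =
  cos ((h%:Z - h'%:Z)%:~R * t) * l2 mu (koop T1 k (koop T1 h r * koop T1 h' r))
     (koop T2 k (koop T2 h f * koop T2 h' f)).
Proof.
rewrite l2p_cis; congr (cos _ * _).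
  by rewrite -mulrBl -intrB; congr (_%:~R * _); lia.
by rewrite !l2E !koopM -!koop_add; congr Ex; ring.
Qed.

Lemma twisted2_average (theta : R) r f : 0 < theta ->
  (forall x, `|f x| <= 1) -> ipn (l2 mu) r <= 2 ->
  (forall t e, 0 < e -> exists N, forall n a, (N <= n)%N ->
     ipn (l2p mu) (avg (twisted T1 t r) a n) <= theta ^+ 2 / 256 + e) ->
  forall t, exists N, forall n a, (N <= n)%N ->
    ipn (l2p mu) (avg (twisted2 t r f) a n) <= theta.
Proof.
(* The mean square will be bounded by [64 delta = (theta / 2)^2]; the other half of [theta] pays for
   the edge term of van der Corput. *)
move=> th0 f1 r2 rsmall t; set delta := theta ^+ 2 / 256 in rsmall.
have d0 : 0 < delta by rewrite divr_gt0// exprn_gt0.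
have [m m0 mP] := correlation_decay d0 r2 rsmall.
have [C rC] := bfun_bounded r.
have C0 : 0 <= C by apply: le_trans (rC point).
have nf : ipn (l2 mu) f <= 1.
  by rewrite -[f]mulr1 -[leRHS]mul1r -{2}(ipn1 mu); exact: ipn_mul_le.
have xC k : ipn (l2p mu) (twisted2 t r f k) <= C.
  rewrite ipn_cis; apply: le_trans (ipn_mul_le mu _ (koop_bound _ _ rC)) _.
  by rewrite ipn_koop -[leRHS]mulr1 ler_wpM2l.
pose phi (p : 'I_m * 'I_m) := koop T1 p.1 r * koop T1 p.2 r.
pose psi (p : 'I_m * 'I_m) := koop T2 p.1 f * koop T2 p.2 f.
have [N1 N1P] : exists N, forall n, (N <= n)%N -> forall (p : 'I_m * 'I_m) a,
    `|avg (fun k => l2 mu (koop T1 k (phi p)) (koop T2 k (psi p)) : R^o) a n -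
      Ex mu (phi p) * Ex mu (psi p)| <= 32 * delta.
  apply: eventually_forall => p.
  have [|N NP] := @joint_average (phi p) (psi p) (32 * delta); first by rewrite mulr_gt0.
  by exists N => n Nn a; exact: NP.
have [N2 N2P] := div_nat_le (2 * m%:R * C) (divr_gt0 th0 (ltr0n R 2)).
exists (maxn N1 N2) => n a; rewrite geq_max => /andP[n1 n2].
apply: le_trans (van_der_corput xC a n m0) _.
rewrite [leRHS]splitr; apply: lerD; first exact: N2P.
have mR : 0 < m%:R :> R by rewrite ltr0n.
have th2 : 0 <= theta / 2 by rewrite divr_ge0// ltW.
have mR0 := ltW mR.
rewrite -[leRHS](ger0_norm th2) -sqrtr_sqr ler_wsqrtr//.
have -> : avg (fun k => ipn (l2p mu) (avg (twisted2 t r f) k m) ^+ 2 : R^o) a n =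
  m%:R^-1 * (m%:R^-1 * \sum_(p : 'I_m * 'I_m) cos ((p.1%:Z - p.2%:Z)%:~R * t) *
    avg (fun k => l2 mu (koop T1 k (phi p)) (koop T2 k (psi p)) : R^o) a n).
  have sq k : ipn (l2p mu) (avg (twisted2 t r f) k m) ^+ 2 =
      m%:R^-1 * (m%:R^-1 * \sum_(p : 'I_m * 'I_m) cos ((p.1%:Z - p.2%:Z)%:~R * t) *
        l2 mu (koop T1 k (phi p)) (koop T2 k (psi p))).
    rewrite ipn_sqr /avg ipZl ipZr ip_suml; congr (_ * (_ * _)).
    rewrite -(pair_bigA _ (fun h h' : 'I_m => cos ((h%:Z - h'%:Z)%:~R * t) *
        l2 mu (koop T1 k (phi (h, h'))) (koop T2 k (psi (h, h'))))) /=.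
    apply: eq_bigr => h _; rewrite ip_sumr; apply: eq_bigr => h' _.
    exact: twisted2_ip.
  rewrite /avg (eq_bigr _ (fun i _ => sq _)) -!mulr_sumr exchange_big /=.
  rewrite -[_ *: _]/(_ * _) mulrCA; congr (_ * _); rewrite mulrCA; congr (_ * _).
  rewrite mulr_sumr; apply: eq_bigr => p _.
  by rewrite -mulr_sumr mulrCA.
have bound (p : 'I_m * 'I_m) : cos ((p.1%:Z - p.2%:Z)%:~R * t) *
    avg (fun k => l2 mu (koop T1 k (phi p)) (koop T2 k (psi p)) : R^o) a n <=
    corr T1 r p.1 p.2 ^+ 2 / (64 * delta) + 48 * delta.
  have h1 := N1P n n1 p a.
  have h2 : `|Ex mu (psi p)| <= 1.
    rewrite -l2E; apply: le_trans (ip_cs _ _ _) _; rewrite !ipn_koop.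
    by rewrite -[leRHS]mulr1 ler_pM.
  have h3 : Ex mu (phi p) = corr T1 r p.1 p.2 by rewrite /corr l2E.
  rewrite h3 in h1.
  set A := avg _ a n in h1 *; set c := corr _ _ _ _ in h1 *.
  (* Only squares of correlations are under control, hence this arithmetic-geometric inequality. It
     is balanced at [|c| = 32 delta], the root mean square bound of [correlation_decay]. *)
  have h4 : `|c| <= c ^+ 2 / (64 * delta) + 16 * delta.
    rewrite -subr_ge0 -[c ^+ 2]real_normK ?num_real//.
    have -> : `|c| ^+ 2 / (64 * delta) + 16 * delta - `|c| =
       (`|c| - 32 * delta) ^+ 2 / (64 * delta) by field; rewrite gt_eqF.
    by rewrite divr_ge0 ?sqr_ge0// mulr_ge0// ltW.
  have h5 : `|A| <= `|c| + 32 * delta.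
    have -> : A = (A - c * Ex mu (psi p)) + c * Ex mu (psi p) by rewrite subrK.
    apply: le_trans (ler_normD _ _) _; rewrite addrC lerD// normrM.
    by rewrite -[leRHS]mulr1 ler_wpM2l.
  apply: le_trans (ler_norm _) _; rewrite normrM.
  apply: (@le_trans _ _ (1 * `|A|)); first by rewrite ler_wpM2r// cos_max.
  lra.
apply: (@le_trans _ _ (m%:R^-1 * (m%:R^-1 * \sum_(p : 'I_m * 'I_m)
    (corr T1 r p.1 p.2 ^+ 2 / (64 * delta) + 48 * delta)))).
  by rewrite !ler_wpM2l ?invr_ge0//; apply: ler_sum => p _; exact: bound.
rewrite big_split /= sumr_const card_prod card_ord -mulr_suml.
rewrite -(pair_bigA _ (fun h h' : 'I_m => corr T1 r h h' ^+ 2)) /=.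
rewrite -[_ *+ (m * m)]mulr_natl natrM.
apply: (@le_trans _ _ (m%:R^-1 * (m%:R^-1 *
   ((32 * delta) ^+ 2 * m%:R ^+ 2 / (64 * delta) + m%:R * m%:R * (48 * delta))))).
  rewrite !ler_wpM2l ?invr_ge0// lerD2r ler_wpM2r// invr_ge0 mulr_ge0//.
  exact: ltW.
have -> : m%:R^-1 * (m%:R^-1 *
   ((32 * delta) ^+ 2 * m%:R ^+ 2 / (64 * delta) + m%:R * m%:R * (48 * delta))) = 64 * delta.
  by field; rewrite !gt_eqF.
by rewrite /delta; lra.
Qed.

End joint_averages.

(** * Trigonometric weights *)

Section weights.
Context (R : realType).
Implicit Types (K : int -> R) (F : seq R).

(** Cosine sums are closed under products, hence under the power taken in [bohr_weight]; the list is
    what [ipn_trig_avg] works with. *)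
Definition trig K := exists s : seq (R * R),
  forall n, K n = \sum_(c <- s) c.1 * cos (n%:~R * c.2).

Lemma trig_cos c t : trig (fun n => c * cos (n%:~R * t)).
Proof. by exists [:: (c, t)] => n; rewrite big_seq1. Qed.

Lemma trig_cst c : trig (fun=> c).
Proof. by exists [:: (c, 0)] => n; rewrite big_seq1 mulr0 cos0 mulr1. Qed.

Lemma trig_add K K' : trig K -> trig K' -> trig (fun n => K n + K' n).
Proof. by move=> [s sP] [s' sP']; exists (s ++ s') => n; rewrite big_cat sP sP'. Qed.

Lemma trig_sum (I : Type) (s : seq I) (G : I -> int -> R) :
  (forall i, trig (G i)) -> trig (fun n => \sum_(i <- s) G i n).
Proof.
move=> GP; elim: s => [|i s IH].
  by have [c cP] := trig_cst 0; exists c => n; rewrite big_nil.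
by have [c cP] := trig_add (GP i) IH; exists c => n; rewrite big_cons.
Qed.

Lemma trig_mul K K' : trig K -> trig K' -> trig (fun n => K n * K' n).
Proof.
move=> [s sP] [s' sP'].
have [c cP] : trig (fun n => \sum_(p <- s) \sum_(p' <- s')
    (p.1 * p'.1 / 2 * cos (n%:~R * (p.2 - p'.2)) +
     p.1 * p'.1 / 2 * cos (n%:~R * (p.2 + p'.2)))).
  by do 2!apply: trig_sum => ?; apply: trig_add; exact: trig_cos.
exists c => n; rewrite -cP sP sP' big_distrlr /=.
apply: eq_bigr => p _; apply: eq_bigr => p' _.
by rewrite mulrBr mulrDr cosB cosD; field.
Qed.

Lemma trig_exp K n : trig K -> trig (fun k => K k ^+ n).
Proof.
move=> KP; elim: n => [|n IH].
  by have [c cP] := trig_cst 1; exists c => k; rewrite expr0.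
by have [c cP] := trig_mul KP IH; exists c => k; rewrite exprS.
Qed.

(** Half the sum of the squares [|exp (i n s) - 1|^2]; its sublevel sets are the Bohr sets of
    [F]. *)
Definition bohr F (n : int) : R := \sum_(s <- F) (1 - cos (n%:~R * s)).

Lemma bohr_ge0 F n : 0 <= bohr F n.
Proof. by apply: sumr_ge0 => s _; rewrite subr_ge0 cos_le1. Qed.

Lemma bohr_le F n : bohr F n <= 2 * (size F)%:R.
Proof.
rewrite /bohr; apply: (@le_trans _ _ (\sum_(s <- F) 2)).
  apply: ler_sum => s _; have := cos_geN1 (n%:~R * s); lra.
by rewrite big_const_seq count_predT iter_addr_0 mulr_natr.
Qed.

Lemma finite_representatives (T : finType) (f : int -> T) :
  exists r : nat, forall m, exists2 n : int, (`|n| <= r)%N & f n = f m.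
Proof.
have /choice [rep repP] : forall c, exists n, (exists m, f m = c) -> f n = c.
  move=> c; have [[m fm]|no] := pselect (exists m, f m = c).
    by exists m.
  by exists 0 => h; case: no.
exists (\max_c `|rep c|%N) => m; exists (rep (f m)); last by apply: repP; exists m.
exact: (@leq_bigmax _ (fun c => `|rep c|%N)).
Qed.

Lemma trunc_dist (Q : nat) (x y : R) : (0 < Q)%N -> 0 <= x -> 0 <= y ->
  Num.trunc (Q%:R * x) = Num.trunc (Q%:R * y) -> `|x - y| <= Q%:R^-1.
Proof.
move=> Q0 x0 y0 e; have QR : 0 < Q%:R :> R by rewrite ltr0n.
have hx := truncn_itv (mulr_ge0 (ltW QR) x0).
have hy := truncn_itv (mulr_ge0 (ltW QR) y0).
rewrite e in hx; case/andP: hx => h1 h2; case/andP: hy => h3 h4.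
rewrite -(ler_pM2l QR) divff ?gt_eqF// -[X in X * _]ger0_norm ?(ltW QR)// -normrM mulrBr.
rewrite ler_norml; move: h2 h4; rewrite -natr1; lra.
Qed.

(* Pigeonhole: two integers whose rotations fall into the same cells differ by
   an element of the Bohr set. *)
Lemma bohr_syndetic F eta : 0 < eta ->
  exists2 L, (0 < L)%N & forall a : int,
    exists2 i : 'I_L, true & bohr F (a + i%:Z) <= eta.
Proof.
move=> eta0; pose d := size F.
have [Q QP] := div_nat_le d%:R eta0.
pose q := Q.+1; have qR : 0 < q%:R :> R by rewrite ltr0n.
have tr (x : R) : -1 <= x -> x <= 1 -> (Num.trunc (q%:R * (x + 1)) <= 2 * q)%N.
  move=> x0 x1; have x10 : 0 <= x + 1 by rewrite -lerBlDr sub0r.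
  have /andP[h _] := truncn_itv (mulr_ge0 (ltW qR) x10).
  rewrite -(ler_nat R); apply: le_trans h _.
  by rewrite natrM mulrC ler_wpM2r ?(ltW qR)//; lra.
pose f (n : int) := [ffun j : 'I_d =>
  (inord (Num.trunc (q%:R * (cos (n%:~R * nth 0 F j) + 1))) : 'I_(2 * q).+1,
   inord (Num.trunc (q%:R * (sin (n%:~R * nth 0 F j) + 1))) : 'I_(2 * q).+1)].
have [r rP] := finite_representatives f.
(* [a + r] falls into the same cells as some [n] in [[-r, r]], and the difference [(a + r) - n] lies
   in [[a, a + 2 r]]. *)
exists (r + r).+1 => // a; have [n nr fn] := rP (a + r%:Z).
have ir : (`|r%:Z - n| < (r + r).+1)%N by lia.
exists (Ordinal ir) => //=.
have -> : a + `|r%:Z - n|%N = (a + r%:Z) - n by lia.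
rewrite /bohr (big_nth 0) big_mkord.
apply: (@le_trans _ _ (\sum_(j < d) (q%:R^-1) ^+ 2)).
  apply: ler_sum => j _; have := congr1 (fun g : {ffun _} => g j) fn.
  rewrite !ffunE => -[] /(congr1 val) /= + /(congr1 val) /=.
  rewrite !inordK ?ltnS ?tr ?cos_geN1 ?cos_le1 ?sin_geN1 ?sin_le1// => h1 h2.
  have sg (x : R) : -1 <= x -> 0 <= x + 1 by move=> ?; rewrite -lerBlDr sub0r.
  have := trunc_dist (ltn0Sn Q) (sg _ (sin_geN1 _)) (sg _ (sin_geN1 _)) h2.
  have := trunc_dist (ltn0Sn Q) (sg _ (cos_geN1 _)) (sg _ (cos_geN1 _)) h1.
  have sqle (x y : R) : `|x + 1 - (y + 1)| <= q%:R^-1 -> (y - x) ^+ 2 <= q%:R^-1 ^+ 2.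
    rewrite (_ : x + 1 - (y + 1) = x - y); last by ring.
    move=> h; rewrite -[leLHS]real_normK ?num_real// distrC.
    by rewrite ler_pXn2r// nnegrE invr_ge0 ltW.
  (* [1 - cos (x - y)] is half of [(cos x - cos y)^2 + (sin x - sin y)^2], hence at most [q^-2]. *)
  move=> /sqle hc /sqle hs; rewrite intrB mulrBl cosB.
  move: hc hs (cos2Dsin2 ((a + r%:Z)%:~R * nth 0 F j)) (cos2Dsin2 (n%:~R * nth 0 F j)).
  set c := cos _; set s := sin _; set c' := cos _; set s' := sin _.
  nra.
rewrite sumr_const card_ord -[_ *+ d]mulr_natl.
have := QP q (leqnSn Q); apply: le_trans.
rewrite expr2 mulrA ler_piMr ?mulr_ge0 ?invr_ge0 ?(ltW qR)//.
by rewrite invf_le1// ler1n.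
Qed.

Lemma sum_syndetic K (b : R) (L : nat) : 0 <= b -> (forall n, 0 <= K n) ->
  (forall a, exists2 i : 'I_L, true & b <= K (a + i%:Z)) ->
  forall q a, q%:R * b <= \sum_(i < q * L) K (a + i%:Z).
Proof.
move=> b0 K0 KL; elim=> [|q IH] a.
  by rewrite mul0r mul0n big_ord0.
rewrite mulSn big_split_ord /= -natr1 mulrDl mul1r addrC lerD//.
  apply: le_trans (IH (a + L%:Z)) _; rewrite le_eqVlt; apply/orP; left; apply/eqP.
  by apply: eq_bigr => i _; rewrite PoszD addrA.
by have [i _ bi] := KL a; rewrite (bigD1 i)//= -[leLHS]addr0 lerD// sumr_ge0.
Qed.

Lemma exists_exp_le (x e : R) : 0 <= x -> x < 1 -> 0 < e -> exists n, x ^+ n <= e.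
Proof.
move=> x0 x1 e0; have : (x ^+ n @[n --> \oo] --> 0).
  by apply: cvg_expr; rewrite ger0_norm.
move=> /cvgrPdist_le /(_ _ e0) [n _ /(_ n (leqnn n)) /=].
by rewrite sub0r normrN => h; exists n; apply: le_trans h; exact: ler_norm.
Qed.

(* [K] is a high power of [1 - bohr F / (2 |F| + 1)]; it concentrates on the
   Bohr sets of [F] because these are syndetic. *)
Lemma bohr_weight F eta : 0 < eta -> exists K kappa (N : nat),
  [/\ trig K, forall n, 0 <= K n, 0 < kappa & forall n a, (N <= n)%N ->
    kappa <= avg (K : int -> R^o) a n /\
    avg (fun k => K k * bohr F k : R^o) a n <= eta * avg (K : int -> R^o) a n].
Proof.
wlog eta1 : eta / eta <= 1 => [H eta0|eta0].
  have [||K [kappa [N [h1 h2 h3 h4]]]] := H (Num.min eta 1).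
  - by rewrite ge_min lexx orbT.
  - by rewrite lt_min eta0 ltr01.
  - exists K, kappa, N; split => // n a /(h4 n a) [h5 h6]; split => //.
    apply: le_trans h6 _; rewrite ler_wpM2r// ?ge_min ?lexx//.
    by apply: le_trans h5; exact: ltW.
pose D : R := 2 * (size F)%:R + 1.
have D0 : 1 <= D by rewrite lerDr mulr_ge0.
have D1 : 0 < D by apply: lt_le_trans D0.
pose v n := 1 - bohr F n / D.
have v0 n : 0 <= v n.
  rewrite subr_ge0 ler_pdivrMr// mul1r; apply: le_trans (bohr_le F n) _.
  by rewrite lerDl.
have vE n : bohr F n = (1 - v n) * D by rewrite /v; field; rewrite gt_eqF.
(* The values of [v] where [bohr F] is [eta / 2] and [eta / 4]. The weight [v ^+ M] is at most
   [al ^+ M] beyond the first level and at least [be ^+ M] on the syndetic set given by the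
   second. *)
pose al := 1 - eta / 2 / D; pose be := 1 - eta / 4 / D.
have eD : 0 < eta / 4 / D by rewrite !divr_gt0.
have eD1 : eta / 4 / D <= 1 / 4 by rewrite ler_pdivrMr//; nra.
have al_be : al = be - eta / 4 / D by rewrite /al /be; field; rewrite gt_eqF.
have be0 : 0 < be by rewrite /be; lra.
have al0 : 0 <= al by rewrite al_be /be; lra.
have [L L0 LP] := @bohr_syndetic F (eta / 4) (divr_gt0 eta0 (ltr0n R 4)).
have LR : 0 < L%:R :> R by rewrite ltr0n.
(* Chosen so that [D al^M] is at most [eta / 2] times [be^M / (2 L)], the lower bound for the mean
   of [K]. *)
have [M MP] : exists M, (al / be) ^+ M <= eta / (4 * L%:R * D).
  apply: exists_exp_le; first by rewrite divr_ge0// ltW.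
    by rewrite ltr_pdivrMr// mul1r al_be gtrBl.
  by rewrite divr_gt0// !mulr_gt0.
have beM : 0 < be ^+ M by rewrite exprn_gt0.
pose K n := v n ^+ M.
have K0 n : 0 <= K n by rewrite exprn_ge0.
have trigv : trig v.
  rewrite (_ : v = fun n => (1 - (size F)%:R / D) + \sum_(s <- F) D^-1 * cos (n%:~R * s)).
    apply: trig_add; first exact: trig_cst.
    by apply: trig_sum => s; exact: trig_cos.
  apply/funext => n; rewrite /v /bohr sumrB big_const_seq count_predT iter_addr_0.
  by rewrite -mulr_sumr; field; rewrite gt_eqF.
exists K, (be ^+ M / (2 * L%:R)), L; split => //; first exact: trig_exp.
  by rewrite divr_gt0// mulr_gt0.
move=> n a Ln; have n0 : (0 < n)%N by apply: leq_trans Ln.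
have nR : 0 < n%:R :> R by rewrite ltr0n.
have lower : be ^+ M / (2 * L%:R) <= avg (K : int -> R^o) a n.
  rewrite /avg -[_ *: _]/(_ * _) [leRHS]mulrC ler_pdivlMr//.
  have KL b : exists2 i : 'I_L, true & be ^+ M <= K (b + i%:Z).
    have [i _ bi] := LP b; exists i => //.
    apply: lerXn2r; rewrite ?nnegrE ?(ltW be0)//.
    by rewrite /be /v lerD2l lerN2 ler_wpM2r// invr_ge0 ltW.
  (* The window contains [n %/ L] disjoint blocks of length [L], and [n %/ L >= n / (2 L)] since
     [n >= L]. *)
  apply: le_trans (le_trans (sum_syndetic (ltW beM) K0 KL (n %/ L)%N a) _).
    rewrite (_ : _ * n%:R = n%:R / (2 * L%:R) * be ^+ M); last by ring.
    rewrite ler_pM2r// ler_pdivrMr ?mulr_gt0//.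
    rewrite -!natrM ler_nat; have := divn_eq n L; have := ltn_pmod n L0.
    have : (0 < n %/ L)%N by rewrite divn_gt0.
    nia.
  have := leq_trunc_div n L; move: (n %/ L * L)%N => q qn.
  by rewrite -(subnKC qn) big_split_ord /= lerDl sumr_ge0.
split => //.
have point k : K k * bohr F k <= eta / 2 * K k + D * al ^+ M.
  have [le|lt] := lerP (bohr F k) (eta / 2).
    rewrite -[leLHS]addr0 mulrC lerD ?ler_wpM2r// mulr_ge0 ?exprn_ge0// ltW//.
  rewrite addrC -[leLHS]addr0 lerD ?mulr_ge0 ?divr_ge0 ?(ltW eta0)//.
  rewrite mulrC ler_pM ?bohr_ge0//.
    by apply: le_trans (bohr_le F k) _; rewrite lerDl.
  apply: lerXn2r; rewrite ?nnegrE// /v /al lerD2l lerN2.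
  by rewrite ler_wpM2r ?invr_ge0 ?(ltW D1)// ltW.
apply: (@le_trans _ _ (eta / 2 * avg (K : int -> R^o) a n + D * al ^+ M)).
  rewrite /avg -![_ *: _]/(_ * _) mulrCA -[D * _](mulKf (lt0r_neq0 nR)) -mulrDr.
  rewrite ler_wpM2l ?invr_ge0 ?(ltW nR)// mulr_sumr.
  apply: (@le_trans _ _ (\sum_(i < n) (eta / 2 * K (a + i%:Z) + D * al ^+ M))).
    by apply: ler_sum => i _; exact: point.
  by rewrite big_split /= sumr_const card_ord -[_ *+ n]mulr_natl.
have : D * al ^+ M <= eta / 2 * (be ^+ M / (2 * L%:R)).
  move: MP; rewrite expr_div_n ler_pdivrMr// => h.
  apply: le_trans (ler_wpM2l (ltW D1) h) _.
  rewrite le_eqVlt; apply/orP; left; apply/eqP; field.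
  by rewrite !gt_eqF.
have := ler_wpM2l (divr_ge0 (ltW eta0) (ler0n R 2)) lower; lra.
Qed.

End weights.

(** * Projection to the span of the eigenfunctions *)

Section almost_periodic.
Context (d : measure_display) (X : measurableType d) (R : realType).
Variables (mu : probability X R) (T1 T2 : mp_action mu).
Local Notation V := (bfun X R).
Local Notation B := (l2 mu).
Implicit Types f g r u v p q : V.

Inductive eigen_span : V -> Prop :=
| span0 : eigen_span 0
| span_add c u v p : eigenpair T1 T2 u v -> eigen_span p -> eigen_span (c *: u + p).

Lemma eigen_spanD p q : eigen_span p -> eigen_span q -> eigen_span (p + q).
Proof.
move=> + qP; elim=> [|c u v p' uv p'P IH]; first by rewrite add0r.
by rewrite -addrA; exact: span_add uv IH.
Qed.

Lemma eigen_spanZ c p : eigen_span p -> eigen_span (c *: p).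
Proof.
elim=> [|c' u v p' uv p'P IH]; first by rewrite scaler0; exact: span0.
by rewrite scalerDr scalerA; exact: span_add uv IH.
Qed.

Lemma eigen_span_eigen u v : eigenpair T1 T2 u v -> eigen_span u.
Proof. by move=> uv; have := span_add 1 uv span0; rewrite scale1r addr0. Qed.

Lemma eigen_span1 : eigen_span 1.
Proof.
apply: (@eigen_span_eigen _ 0); split.
- by exists 0; apply: aeW => x; rewrite !bfunE cos0 sin0; split; ring.
- by exists 0; apply: aeW => x; rewrite !bfunE cos0 sin0; split; ring.
- by apply: aeW => x; rewrite !bfunE; ring.
Qed.

Lemma eigenpair_ipn u v : eigenpair T1 T2 u v -> ipn B u <= 1.
Proof.
move=> [_ _ uv]; rewrite ipn_le// l2E expr1n -(Ex1 mu); apply: Ex_le.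
by apply: filterS uv => x h; rewrite !bfunE -h expr2 lerDl sqr_ge0.
Qed.

Lemma rotates_dist (T : mp_action mu) t u v n : rotates T t u v ->
  {ae mu, forall x, u x ^+ 2 + v x ^+ 2 = 1} ->
  ipn B (koop T n u - u) ^+ 2 <= 2 * (1 - cos (n%:~R * t)).
Proof.
move=> rot uv; rewrite ipn_sqr l2E.
have -> : 2 * (1 - cos (n%:~R * t)) = Ex mu ((2 * (1 - cos (n%:~R * t))) *: (1 : V)).
  by rewrite ExZ Ex1 mulr1.
apply: Ex_le; apply: filterS2 uv (rotates_pow n rot) => x h [h1 h2].
rewrite !bfunE koopE h1; set c := cos _; set s := sin _.
have cs : c ^+ 2 + s ^+ 2 = 1 by rewrite cos2Dsin2.
rewrite -subr_ge0.
(* The right-hand side is the squared increment of [v]: on the unit circle the squared increments of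
   [u] and [v] add up to [2 (1 - cos (n t))]. *)
have -> : 2 * (1 - c) * 1 - (c * u x - s * v x + - u x) * (c * u x - s * v x + - u x) =
    (s * u x + c * v x - v x) ^+ 2.
  transitivity (2 * (1 - c) * (u x ^+ 2 + v x ^+ 2) +
    (c ^+ 2 + s ^+ 2 - 1) * (u x ^+ 2 + v x ^+ 2) -
    (c * u x - s * v x + - u x) * (c * u x - s * v x + - u x)).
    by rewrite h cs; ring.
  by ring.
exact: sqr_ge0.
Qed.

(** [F] collects the angles of all summands for both actions, so that one Bohr set controls both.
    The constants come from [|x + y|^2 <= 2 |x|^2 + 2 |y|^2]. *)
Lemma eigen_span_bohr p : eigen_span p -> exists F (C : R), 0 <= C /\
  forall n, ipn B (koop T1 n p - p) ^+ 2 <= C * bohr F n /\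
            ipn B (koop T2 n p - p) ^+ 2 <= C * bohr F n.
Proof.
elim=> [|c u v p' [[t1 r1] [t2 r2] uv] _ [F [C [C0 FC]]]].
  exists [::], 0; split => // n.
  have k0 T : koop T n (0 : V) - 0 = 0 by rewrite subr0; exact: bfun_ext.
  by rewrite !k0 ipn0 expr0n mul0r.
exists [:: t1, t2 & F], (4 * c ^+ 2 + 2 * C); split.
  by apply: addr_ge0; apply: mulr_ge0 => //; exact: sqr_ge0.
have c2 := sqr_ge0 c.
have step (T : mp_action mu) n x : ipn B (koop T n u - u) ^+ 2 <= 2 * x ->
    ipn B (koop T n p' - p') ^+ 2 <= C * bohr F n ->
    ipn B (koop T n (c *: u + p') - (c *: u + p')) ^+ 2 <=
      4 * c ^+ 2 * x + 2 * C * bohr F n.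
  move=> h1 h2.
  have -> : koop T n (c *: u + p') - (c *: u + p') =
      c *: (koop T n u - u) + (koop T n p' - p').
    by rewrite koopD koopZ scalerBr opprD addrACA.
  have par := parallelogram B (c *: (koop T n u - u)) (koop T n p' - p').
  have h3 : ipn B (c *: (koop T n u - u)) ^+ 2 <= 2 * c ^+ 2 * x.
    rewrite ipnZ exprMn real_normK ?num_real//.
    apply: le_trans (ler_wpM2l c2 h1) _.
    by rewrite le_eqVlt; apply/orP; left; apply/eqP; ring.
  have h4 := sqr_ge0 (ipn B (c *: (koop T n u - u) - (koop T n p' - p'))).
  lra.
move=> n; have [h1 h2] := FC n.
have b0 := bohr_ge0 F n.
have x1 : 0 <= 1 - cos (n%:~R * t1) by rewrite subr_ge0 cos_le1.
have x2 : 0 <= 1 - cos (n%:~R * t2) by rewrite subr_ge0 cos_le1.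
have CB := mulr_ge0 C0 b0.
have Cx1 := mulr_ge0 C0 x1; have Cx2 := mulr_ge0 C0 x2.
have cB := mulr_ge0 c2 b0; have cx1 := mulr_ge0 c2 x1; have cx2 := mulr_ge0 c2 x2.
rewrite /bohr !big_cons -/(bohr F n); split.
  apply: le_trans (step T1 n _ (rotates_dist n r1 uv) h1) _; nra.
apply: le_trans (step T2 n _ (rotates_dist n r2 uv) h2) _; nra.
Qed.

(** * Almost orthogonal projection to the span *)

Section nearest.
Variable f : V.

Let dist2 : set R := [set ipn B (f - q) ^+ 2 | q in eigen_span].
Let D := inf dist2.

Let D_le q : eigen_span q -> D <= ipn B (f - q) ^+ 2.
Proof.
move=> qP; apply: ge_inf; last by exists q.
by exists 0 => _ [q' _ <-]; exact: sqr_ge0.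
Qed.

(** The infimum [D] need not be attained in the span. The slack is quadratic in [e] so that
    orthogonality fails by at most [e]. *)
Definition near_projection (e : R) p := eigen_span p /\ ipn B (f - p) ^+ 2 <= D + e ^+ 2.

Lemma exists_near_projection e : 0 < e -> exists p, near_projection e p.
Proof.
move=> e0; have [||_ [p pP <-] lt] := @inf_adherent _ dist2 (e ^+ 2).
- by rewrite exprn_gt0.
- split; first by exists (ipn B (f - 0) ^+ 2); exists 0 => //; exact: span0.
  by exists 0 => _ [q' _ <-]; exact: sqr_ge0.
- by exists p; split => //; exact: ltW.
Qed.

(** Moving [p] along [q] cannot bring the squared distance below [D]. At the best step
    [c = b / |q|^2] this says [0 <= e^2 - b^2 / |q|^2]. *)
Lemma near_projection_orth e p q : 0 < e -> near_projection e p -> eigen_span q ->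
  `|B (f - p) q| <= e * ipn B q.
Proof.
move=> e0 [pP pD] qP; set b := B (f - p) q.
have H c : 0 <= e ^+ 2 - 2 * c * b + c ^+ 2 * ipn B q ^+ 2.
  have := D_le (eigen_spanD pP (eigen_spanZ c qP)).
  rewrite opprD addrA {}/b; move: pD; move: (f - p) => y.
  rewrite (ipn_sqr B (y - _)) ipBl !ipBr !ipZl !ipZr (ipC B q) -!ipn_sqr; lra.
have [q0|q0] := eqVneq (ipn B q) 0.
  by apply: le_trans (ip_cs _ _ _) _; rewrite q0 !mulr0.
have Q0 : 0 < ipn B q by rewrite lt_def q0 ipn_ge0.
rewrite -(@ler_pXn2r _ 2)// ?nnegrE ?mulr_ge0 ?(ltW e0)//.
rewrite real_normK ?num_real// exprMn.
have := H (b / ipn B q ^+ 2).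
rewrite -(@pmulr_lge0 _ (ipn B q ^+ 2)) ?exprn_gt0// -subr_ge0.
by congr (0 <= _); field.
Qed.

(** The midpoint of [p] and [p'] belongs to the span, so its squared distance from [f] is at least
    [D]; the parallelogram law does the rest. *)
Lemma near_projection_close e e' p p' : near_projection e p -> near_projection e' p' ->
  ipn B (p' - p) ^+ 2 <= 2 * (e ^+ 2 + e' ^+ 2).
Proof.
move=> [pP pD] [pP' pD'].
have -> : p' - p = (f - p) - (f - p') by rewrite opprB [RHS]addrC addrA subrK.
rewrite parallelogram.
have -> : (f - p) + (f - p') = 2 *: (f - 2^-1 *: (p + p')).
  rewrite scalerBr scalerA divff// scale1r scaler_nat mulr2n opprD.
  by rewrite addrACA.
rewrite ipnZ exprMn ger0_norm//.
have := D_le (eigen_spanZ 2^-1 (eigen_spanD pP pP')); lra.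
Qed.

Lemma near_projection_dist e p : near_projection e p ->
  ipn B (f - p) ^+ 2 <= ipn B f ^+ 2 + e ^+ 2.
Proof.
move=> [_ pD]; apply: le_trans pD _; rewrite lerD2r.
by have := D_le span0; rewrite subr0.
Qed.

Lemma near_projection_small e p : 0 < e -> near_projection e p ->
  eigen_small T1 T2 e (f - p).
Proof.
move=> e0 pP u v uv.
apply: le_trans (near_projection_orth e0 pP (eigen_span_eigen uv)) _.
by rewrite -[leRHS]mulr1 ler_wpM2l ?(ltW e0)// (eigenpair_ipn uv).
Qed.

End nearest.

End almost_periodic.

(** * The lower bound *)

Section weighted_averages.
Context (R : realType) (V : lmodType R) (B : semi_ip V).
Variables (K : int -> R) (a : int) (n : nat).
Hypothesis K0 : forall k, 0 <= K k.

Local Notation "<| u |>" := (avg (u : int -> R^o) a n).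

Lemma avg_le (u v : int -> R) : (forall k, u k <= v k) -> <|u|> <= <|v|>.
Proof. by move=> uv; apply: ler_wpM2l; rewrite ?invr_ge0// ler_sum. Qed.

Lemma avgD (W : lmodType R) (u v : int -> W) :
  avg (fun k => u k + v k) a n = avg u a n + avg v a n.
Proof. by rewrite /avg big_split scalerDr. Qed.

Lemma avgZ (W : lmodType R) (c : R) (u : int -> W) :
  avg (fun k => c *: u k) a n = c *: avg u a n.
Proof. by rewrite /avg -scaler_sumr !scalerA mulrC. Qed.

Lemma ipn_wavg (u : int -> V) :
  ipn B (avg (fun k => K k *: u k) a n) <= <|fun k => K k * ipn B (u k)|>.
Proof.
rewrite /avg ipnZ ger0_norm ?invr_ge0// ler_wpM2l ?invr_ge0//.
apply: le_trans (ipn_sum _ _ _ _) _; apply: ler_sum => i _.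
by rewrite ipnZ ger0_norm.
Qed.

Lemma wavg_le (u : int -> R) (c : R) : (forall k, u k <= c) ->
  <|fun k => K k * u k|> <= c * <|K|>.
Proof.
move=> uc; rewrite -[leRHS]/(c *: _) -(avgZ (W := R^o)); apply: avg_le => k.
by rewrite mulrC ler_wpM2r.
Qed.

(** Mean squares control means through [u <= u^2 / (2 eta) + eta / 2]. *)
Lemma wavg_of_sqr (u b : int -> R) (C eta : R) : 0 < eta -> (forall k, 0 <= u k) ->
  (forall k, u k ^+ 2 <= C * b k) ->
  C * <|fun k => K k * b k|> <= eta ^+ 2 * <|K|> ->
  <|fun k => K k * u k|> <= eta * <|K|>.
Proof.
move=> eta0 u0 ub le.
apply: (@le_trans _ _ <|fun k => (2 * eta)^-1 * (C * (K k * b k)) + eta / 2 * K k|>).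
  apply: avg_le => k.
  rewrite (_ : _ + _ = K k * ((2 * eta)^-1 * (C * b k) + eta / 2)); last by ring.
  rewrite ler_wpM2l//.
  apply: (@le_trans _ _ ((2 * eta)^-1 * u k ^+ 2 + eta / 2)); last first.
    by rewrite lerD2r ler_wpM2l ?invr_ge0 ?mulr_ge0 ?(ltW eta0).
  rewrite -subr_ge0.
  rewrite (_ : _ - _ = (2 * eta)^-1 * (u k - eta) ^+ 2); last by field; rewrite gt_eqF.
  by rewrite mulr_ge0 ?sqr_ge0 ?invr_ge0 ?mulr_ge0 ?(ltW eta0).
rewrite (avgD (W := R^o)) !(avgZ (W := R^o)).
rewrite -![_ *: _]/(_ * _).
apply: (@le_trans _ _ ((2 * eta)^-1 * (eta ^+ 2 * <|K|>) + eta / 2 * <|K|>)).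
  by rewrite lerD2r ler_wpM2l ?invr_ge0 ?mulr_ge0 ?(ltW eta0).
by rewrite le_eqVlt; apply/orP; left; apply/eqP; field; rewrite gt_eqF.
Qed.

End weighted_averages.

Section trigonometric_weights.
Context (d : measure_display) (X : measurableType d) (R : realType).
Variable mu : probability X R.
Local Notation V := (bfun X R).

(** A cosine weight is the first component of a twist, so bounds at single frequencies add up with
    the coefficients. *)
Lemma ipn_trig_avg (s : seq (R * R)) (y : int -> V) a n (theta : R) :
  0 <= theta ->
  (forall i : 'I_(size s), ipn (l2p mu)
     (avg (fun k => cis (k%:~R * (nth (0, 0) s i).2) (y k)) a n) <= theta) ->
  ipn (l2 mu) (avg (fun k => (\sum_(c <- s) c.1 * cos (k%:~R * c.2)) *: y k) a n) <=
  (\sum_(c <- s) `|c.1|) * theta.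
Proof.
move=> th0 H; rewrite [X in _ <= X * _](big_nth (0, 0)) big_mkord mulr_suml.
have -> : avg (fun k => (\sum_(c <- s) c.1 * cos (k%:~R * c.2)) *: y k) a n =
  \sum_(i < size s) (nth (0, 0) s i).1 *:
    (avg (fun k => cis (k%:~R * (nth (0, 0) s i).2) (y k)) a n).1.
  under [RHS]eq_bigr do rewrite avg_fst /avg /= scalerA mulrC -scalerA scaler_sumr.
  rewrite -scaler_sumr exchange_big /= /avg; congr (_ *: _).
  apply: eq_bigr => j _; rewrite (big_nth (0, 0)) big_mkord scaler_suml.
  by apply: eq_bigr => i _; rewrite scalerA.
apply: le_trans (ipn_sum _ _ _ _) _; apply: ler_sum => i _.
by rewrite ipnZ ler_wpM2l//; exact: le_trans (ipn_fst mu _) (H i).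
Qed.

End trigonometric_weights.

(** Used with [m = Ex mu f], [z = B f Phi] and [y = |f Phi|^2]. The lower bound for [z] is squared
    only when it is positive; otherwise [m^3 <= m^2 <= 8 eta]. *)
Lemma cube_lower_bound (R : realType) (m y z eta : R) :
  0 <= m <= 1 -> 0 <= eta -> 0 <= y ->
  z ^+ 2 <= m * y -> m ^+ 2 - 8 * eta <= z -> m ^+ 3 - 16 * eta <= y.
Proof.
move=> /andP[m0 m1] eta0 y0 zy zm.
have [small|big] := lerP (m ^+ 2) (8 * eta).
  have : m ^+ 3 <= m ^+ 2 by rewrite exprS ler_piMl ?sqr_ge0.
  lra.
have m_gt0 : 0 < m.
  by rewrite lt_def m0 andbT; apply: contraTneq big => ->; rewrite expr0n -leNgt mulr_ge0.
have h : (m ^+ 2 - 8 * eta) ^+ 2 <= m * y.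
  by apply: le_trans zy; rewrite lerXn2r// nnegrE; lra.
have h2 : m * (m ^+ 3 - 16 * eta) <= m * y.
  apply: le_trans h; have := sqr_ge0 (8 * eta); have : m ^+ 2 <= m by rewrite expr2 ler_piMl.
  have -> : (m ^+ 2 - 8 * eta) ^+ 2 = m ^+ 4 - 16 * eta * m ^+ 2 + (8 * eta) ^+ 2 by ring.
  have -> : m * (m ^+ 3 - 16 * eta) = m ^+ 4 - 16 * eta * m by ring.
  nra.
by rewrite ler_pM2l in h2.
Qed.

Section khintchine.
Context (d : measure_display) (X : measurableType d) (R : realType).
Variables (mu : probability X R) (T1 T2 S : mp_action mu).
Hypothesis T1S : forall n x, T1 n x = S n (T2 n x).
Hypothesis T12 : forall x, T1 1 (T2 1 x) = T2 1 (T1 1 x).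
Hypothesis erg1 : ergodic mu (T1 1).
Hypothesis erg2 : ergodic mu (T2 1).
Hypothesis ergS : ergodic mu (S 1).
Local Notation V := (bfun X R).
Local Notation B := (l2 mu).
Implicit Types f g r p q : V.

Section structured.
Variables (f p : V) (eta : R).
Hypothesis ff : f * f = f.
Hypothesis eta0 : 0 < eta.
Hypothesis eta1 : eta <= 1.
Hypothesis pP : near_projection T1 T2 f eta p.

Lemma idem_bound x : `|f x| <= 1.
Proof.
have := congr1 (fun g : V => g x) ff; rewrite bfunE => h.
rewrite ler_norml; nra.
Qed.

Lemma idem_ipn : ipn B f ^+ 2 = Ex mu f.
Proof. by rewrite ipn_sqr l2E ff. Qed.

Lemma idem_Ex : 0 <= Ex mu f <= 1.
Proof.
rewrite -{1}ff -l2E ip_ge0 /= -(Ex1 mu); apply: Ex_le; apply: aeW => x.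
by rewrite bfunE; apply: le_trans (ler_norm _) (idem_bound x).
Qed.

Lemma idem_ipn_le1 : ipn B f <= 1.
Proof. by rewrite ipn_le// -ipn_sqr idem_ipn expr1n; case/andP: idem_Ex. Qed.

Lemma idem_mul_le g : ipn B (f * g) <= ipn B g.
Proof. by rewrite -[leRHS]mul1r; apply: ipn_mul_le; exact: idem_bound. Qed.

(** [f - p] is almost orthogonal to [p] and to [1]: the former puts [B f p] near [|p|^2], the latter
    the mean of [p] near that of [f]. Each costs [2 eta]. *)
Lemma structured_ip : Ex mu f ^+ 2 - 4 * eta <= B f p.
Proof.
have [pS _] := pP.
have h1 := near_projection_orth eta0 pP pS.
have h2 := near_projection_orth eta0 pP (eigen_span1 T1 T2).
rewrite ipn1 mulr1 ipBl -Ex_l2 in h2; rewrite ipBl -ipn_sqr in h1.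
have h3 := ip_le B f p; have h4 := idem_ipn_le1.
have h5 := ip_cs B p 1; rewrite ipn1 mulr1 in h5.
have p0 := ipn_ge0 B p.
have p2 : ipn B p <= 2.
  have [->//|pn0] := eqVneq (ipn B p) 0.
  have {}pn0 : 0 < ipn B p by rewrite lt_def pn0.
  have : ipn B p * ipn B p <= 2 * ipn B p.
    move: h1; rewrite ler_norml => /andP[h1 _].
    have : ipn B f * ipn B p <= 1 * ipn B p by rewrite ler_wpM2r.
    have : eta * ipn B p <= 1 * ipn B p by rewrite ler_wpM2r.
    rewrite -expr2; lra.
  by rewrite ler_pM2r.
have /andP[m0 m1] := idem_Ex.
move: h1 h2 h5; rewrite !ler_norml => /andP[h1 _] /andP[_ h2] /andP[_ h5].
have h6 : (Ex mu f) ^+ 2 - 2 * eta <= ipn B p ^+ 2.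
  have [le|lt] := lerP (Ex mu f) eta; first by nra.
  have : (Ex mu f - eta) ^+ 2 <= ipn B p ^+ 2 by apply: lerXn2r; rewrite ?nnegrE//; lra.
  have : eta * Ex mu f <= eta * 1 by rewrite ler_wpM2l// ltW.
  have := sqr_ge0 eta; rewrite sqrrB; lra.
have : eta * ipn B p <= eta * 2 by rewrite ler_wpM2l// ltW.
lra.
Qed.

(** Exchanging [p] and [Phi] costs [4 eta] twice, in [B f p] and at the end. In between, [f * f = f]
    allows Cauchy-Schwarz for [f] and [f * Phi], with a loss of [16 eta]. *)
Lemma structured_triple Phi : ipn B (f * Phi) <= 1 -> ipn B (Phi - p) <= 4 * eta ->
  Ex mu f ^+ 3 - 20 * eta <= B (f * Phi) p.
Proof.
move=> fPhi Phip.
have h1 : Ex mu f ^+ 2 - 8 * eta <= B f Phi.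
  have : `|B f (Phi - p)| <= 4 * eta.
    apply: le_trans (ip_cs _ _ _) _; rewrite -[leRHS]mul1r.
    by apply: ler_pM => //; exact: idem_ipn_le1.
  rewrite ipBr ler_norml => /andP[h _]; have := structured_ip; lra.
have h2 : B f Phi ^+ 2 <= Ex mu f * ipn B (f * Phi) ^+ 2.
  have -> : B f Phi = B f (f * Phi) by rewrite !l2E mulrA ff.
  apply: le_trans (ip_cs2 _ _ _) _; by rewrite -!ipn_sqr idem_ipn.
have h3 := cube_lower_bound idem_Ex (ltW eta0) (sqr_ge0 _) h2 h1.
have h4 : B (f * Phi) Phi = ipn B (f * Phi) ^+ 2.
  by rewrite ipn_sqr !l2E mulrACA ff -mulrA.
have : `|B (f * Phi) (Phi - p)| <= 4 * eta.
  by apply: le_trans (ip_cs _ _ _) _; rewrite -[leRHS]mul1r ler_pM.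
rewrite ipBr h4 ler_norml => /andP[_]; lra.
Qed.

End structured.

Lemma khintchine f e : f * f = f -> 0 < e -> exists L : nat, forall a : int,
  exists2 i : nat, (i < L)%N &
    Ex mu f ^+ 3 - e < B f (koop T1 (a + i%:Z) f * koop T2 (a + i%:Z) f).
Proof.
move=> ff e0.
(* [24] is the [20] of [structured_triple] plus [1 + 2 + 1] for the three errors made when [p]
   replaces [T1^k f]. *)
have [eta [eta0 eta1 eta_e]] : exists eta : R, [/\ 0 < eta, eta <= 1 & 24 * eta < e].
  exists (Num.min 1 (e / 25)); split; first by rewrite lt_min ltr01 divr_gt0.
    by rewrite ge_min lexx.
  have : Num.min 1 (e / 25) <= e / 25 by rewrite ge_min lexx orbT.
  lra.
have [p pP] := exists_near_projection T1 T2 f eta0.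
have [F [C [C0 FC]]] := eigen_span_bohr pP.1.
have CC : 0 < eta ^+ 2 / (C + 1) by rewrite divr_gt0 ?exprn_gt0// ltr_wpDl.
have [K [kappa [N1 [[s sP] K0 kappa0 KP]]]] := bohr_weight F CC.
pose A := \sum_(c <- s) `|c.1|.
have A0 : 0 <= A by apply: sumr_ge0.
(* An error [theta] at each frequency grows to [A * theta], which is then at most [eta] times the
   mean of the weight. *)
pose theta := eta * kappa / (A + 1).
have theta0 : 0 < theta by rewrite divr_gt0 ?mulr_gt0// ltr_wpDl.
have Atheta : A * theta <= eta * kappa.
  rewrite /theta mulrCA; apply: ler_piMr.
    by rewrite mulr_ge0 ?(ltW eta0) ?(ltW kappa0).
  by rewrite ler_pdivrMr ?ltr_wpDl// mul1r lerDl.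
(* The three bounds serve for the distance from [p'] to [p], for [twisted2_average] and for the
   averages of [T2^k r]. *)
pose delta := Num.min eta (Num.min (theta ^+ 2 / 256) (theta / 2)).
have delta0 : 0 < delta.
  rewrite lt_min eta0 lt_min /=; apply/andP; split; first by rewrite divr_gt0// exprn_gt0.
  by rewrite divr_gt0.
have delta1 : delta <= eta by rewrite ge_min lexx.
have delta2 : delta <= theta ^+ 2 / 256 by rewrite ge_min ge_min lexx orbT.
have delta3 : delta <= theta / 2 by rewrite ge_min ge_min lexx !orbT.
(* [p] has fixed the weight and thereby [theta]; only now is it known how small the residual must
   be. *)
have [p' p'P] := exists_near_projection T1 T2 f delta0.
pose r := f - p'.
have rsmall : eigen_small T1 T2 delta r by exact: near_projection_small.
have f_le1 := idem_ipn_le1 ff.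
have r2 : ipn B r <= 2.
  rewrite ipn_le// -ipn_sqr; apply: le_trans (near_projection_dist p'P) _.
  have : ipn B f ^+ 2 <= 1 by rewrite expr_le1.
  have : delta ^+ 2 <= 1 by rewrite expr_le1 ?(ltW delta0)// (le_trans delta1).
  lra.
have pp' : ipn B (p' - p) <= 2 * eta.
  have eta20 : 0 <= 2 * eta by rewrite mulr_ge0// ltW.
  rewrite (ipn_le _ _ eta20) -ipn_sqr.
  apply: le_trans (near_projection_close pP p'P) _.
  have : delta ^+ 2 <= eta ^+ 2.
    by apply: lerXn2r; rewrite ?nnegrE ?(ltW eta0) ?(ltW delta0).
  rewrite exprMn; lra.
have small1 t e' : 0 < e' -> exists N, forall n a, (N <= n)%N ->
    ipn (l2p mu) (avg (twisted T1 t r) a n) <= theta ^+ 2 / 256 + e'.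
  move=> /(eigen_small_avg T12 erg1 t (ltW delta0) rsmall)[N NP].
  by exists N => n a /(NP n a) h; apply: le_trans h _; rewrite lerD2r.
have [N2 N2P] : exists N, forall n, (N <= n)%N -> forall (i : 'I_(size s)) a,
    ipn (l2p mu) (avg (twisted2 T1 T2 (nth (0, 0) s i).2 r f) a n) <= theta.
  apply: eventually_forall => i.
  have [N NP] := twisted2_average T1S ergS theta0 (idem_bound ff) r2 small1
    (nth (0, 0) s i).2.
  by exists N => n Nn a; exact: NP.
have [N3 N3P] : exists N, forall n, (N <= n)%N -> forall (i : 'I_(size s)) a,
    ipn (l2p mu) (avg (twisted T2 (nth (0, 0) s i).2 r) a n) <= theta.
  apply: eventually_forall => i; have th2 : 0 < theta / 2 by rewrite divr_gt0.
  have [N NP] := eigen_small_avg (fun x => esym (T12 x)) erg2 (nth (0, 0) s i).2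
    (ltW delta0) (eigen_smallC rsmall) th2.
  exists N => n Nn a; apply: le_trans (NP n a Nn) _; lra.
pose n := maxn N1 (maxn N2 N3).
(* Without a good time in [[a, a + n)], the weighted mean of the correlations would be at most
   [(Ex mu f ^+ 3 - e) * kb], against [lower]. *)
exists n => a; apply: contrapT => no.
have [kb_ge bohr_le'] := KP n a (leq_maxl _ _).
set kb := avg (K : int -> R^o) a n in kb_ge bohr_le'.
have kb0 : 0 < kb by apply: lt_le_trans kb_ge.
have wtrig (y : int -> V) : (forall i : 'I_(size s), ipn (l2p mu)
     (avg (fun k => cis (k%:~R * (nth (0, 0) s i).2) (y k)) a n) <= theta) ->
    ipn B (avg (fun k => K k *: y k) a n) <= eta * kb.
  move=> /(ipn_trig_avg (ltW theta0)) h.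
  rewrite (_ : (fun k => _) =
    (fun k => (\sum_(c <- s) c.1 * cos (k%:~R * c.2)) *: y k)); last first.
    by apply/funext => k; rewrite sP.
  apply: le_trans h _; apply: le_trans Atheta _.
  by rewrite ler_wpM2l// ltW.
have E1 : ipn B (avg (fun k => K k *: (koop T1 k r * koop T2 k f)) a n) <= eta * kb.
  by apply: wtrig => i; apply: N2P; rewrite !leq_max leqnn orbT.
have E2 : ipn B (avg (fun k => K k *: koop T2 k r) a n) <= eta * kb.
  by apply: wtrig => i; apply: N3P; rewrite !leq_max leqnn !orbT.
have Cbohr : C * avg (fun k => K k * bohr F k : R^o) a n <= eta ^+ 2 * kb.
  apply: le_trans (ler_wpM2l C0 bohr_le') _.
  rewrite (_ : C * _ = C / (C + 1) * (eta ^+ 2 * kb)); last by ring.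
  apply: ler_piMl; first by rewrite mulr_ge0 ?sqr_ge0 ?(ltW kb0).
  by rewrite ler_pdivrMr ?ltr_wpDl// mul1r lerDl.
have E3 : avg (fun k => K k * ipn B (koop T1 k p - p) : R^o) a n <= eta * kb.
  by apply: (wavg_of_sqr K0 eta0 _ _ Cbohr) => k //; exact: (FC k).1.
have E4 : avg (fun k => K k * ipn B (koop T2 k p - p) : R^o) a n <= eta * kb.
  by apply: (wavg_of_sqr K0 eta0 _ _ Cbohr) => k //; exact: (FC k).2.
pose Phi' := avg (fun k => K k *: koop T2 k f) a n.
(* By [f = r + (p' - p) + p] the errors, relative to [kb], are [eta], [2 eta] and, from the Bohr
   set, [eta]. *)
have Phi'p : ipn B (Phi' - kb *: p) <= 4 * eta * kb.
  have fE : f = r + (p' - p) + p by rewrite /r addrA !subrK.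
  have -> : Phi' - kb *: p = avg (fun k => K k *: koop T2 k r) a n +
      avg (fun k => K k *: koop T2 k (p' - p)) a n +
      avg (fun k => K k *: (koop T2 k p - p)) a n.
    rewrite /Phi' -!avgD.
    have -> : kb *: p = avg (fun k => K k *: p) a n.
      by rewrite /avg -scaler_suml scalerA.
    rewrite -scaleN1r -avgZ -avgD; congr (_ *: _); apply: eq_bigr => i _.
    rewrite scaleN1r -scalerBr -!scalerDr; congr (_ *: _).
    by rewrite fE !koopD !addrA.
  have h1 : ipn B (avg (fun k => K k *: koop T2 k (p' - p)) a n) <= 2 * eta * kb.
    apply: le_trans (ipn_wavg _ _ _ K0 _) _.
    by apply: wavg_le => // k; rewrite ipn_koop.
  have h2 : ipn B (avg (fun k => K k *: (koop T2 k p - p)) a n) <= eta * kb.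
    exact: le_trans (ipn_wavg _ _ _ K0 _) E4.
  apply: le_trans (ipnD _ _ _) _; have := ipnD B (avg (fun k => K k *: koop T2 k r) a n)
    (avg (fun k => K k *: koop T2 k (p' - p)) a n); lra.
have fPhi' : ipn B (f * Phi') <= kb.
  apply: le_trans (idem_mul_le ff _) _; apply: le_trans (ipn_wavg _ _ _ K0 _) _.
  by rewrite -[leRHS]mul1r; apply: wavg_le => // k; rewrite ipn_koop.
pose Phi := kb^-1 *: Phi'.
have PhiE : Phi' = kb *: Phi by rewrite scalerA divff ?gt_eqF// scale1r.
have main : kb * (Ex mu f ^+ 3 - 20 * eta) <= B (f * Phi') p.
  have -> : B (f * Phi') p = kb * B (f * Phi) p by rewrite PhiE bfun_scaleAr ipZl.
  rewrite ler_pM2l//; apply: (structured_triple ff eta0 eta1 pP).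
    rewrite /Phi bfun_scaleAr ipnZ ger0_norm ?invr_ge0 ?(ltW kb0)//.
    by rewrite ler_pdivrMl// mulr1.
  have -> : Phi - p = kb^-1 *: (Phi' - kb *: p).
    by rewrite scalerBr; congr (_ - _); rewrite scalerA mulVf ?gt_eqF// scale1r.
  rewrite ipnZ ger0_norm ?invr_ge0 ?(ltW kb0)// ler_pdivrMl//.
  by apply: le_trans Phi'p _; rewrite mulrC.
pose c k := B f (koop T1 k f * koop T2 k f).
have lower : kb * (Ex mu f ^+ 3 - 24 * eta) <= avg (fun k => K k * c k : R^o) a n.
  have -> : kb * (Ex mu f ^+ 3 - 24 * eta) =
      - (eta * kb) - 2 * eta * kb - eta * kb + kb * (Ex mu f ^+ 3 - 20 * eta) by ring.
  (* The term with [r] is small only as an average, so [E1] is used before the comparison term by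
     term; the other two errors are estimated for each [k]. *)
  apply: (@le_trans _ _ (B (avg (fun k => K k *: (koop T1 k r * koop T2 k f)) a n) f
    - 2 * eta * kb - avg (fun k => K k * ipn B (koop T1 k p - p) : R^o) a n
    + B (f * Phi') p)).
    apply: lerD => //; apply: lerB => //; apply: lerB => //.
    have : `|B (avg (fun k => K k *: (koop T1 k r * koop T2 k f)) a n) f| <= eta * kb.
      by apply: le_trans (ip_cs _ _ _) _; rewrite -[leRHS]mulr1 ler_pM.
    by rewrite ler_norml => /andP[].
  have -> : B (f * Phi') p = avg (fun k => K k * B f (p * koop T2 k f) : R^o) a n.
    have -> : B (f * Phi') p = B Phi' (f * p) by rewrite !l2E; congr Ex; ring.
    rewrite ip_avgl; congr (_ *: _); apply: eq_bigr => i _; rewrite ipZl; congr (_ * _).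
    by rewrite !l2E; congr Ex; ring.
  rewrite ip_avgl.
  have -> : avg (fun k => B (K k *: (koop T1 k r * koop T2 k f)) f : R^o) a n -
      2 * eta * kb - avg (fun k => K k * ipn B (koop T1 k p - p) : R^o) a n +
      avg (fun k => K k * B f (p * koop T2 k f) : R^o) a n =
    avg (fun k => B (K k *: (koop T1 k r * koop T2 k f)) f - 2 * eta * K k -
      K k * ipn B (koop T1 k p - p) + K k * B f (p * koop T2 k f) : R^o) a n.
    rewrite /kb /avg -![_ *: _]/(_ * _) [in RHS]big_split /= !sumrB -mulr_sumr.
    ring.
  apply: avg_le => k.
  rewrite ipZl (mulrC _ (K k)) -!mulrBr -mulrDr ler_wpM2l// /c.
  have h1 : `|B f (koop T1 k (p' - p) * koop T2 k f)| <= 2 * eta.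
    have -> : B f (koop T1 k (p' - p) * koop T2 k f) =
        B (f * koop T2 k f) (koop T1 k (p' - p)) by rewrite !l2E; congr Ex; ring.
    apply: le_trans (ip_cs _ _ _) _; rewrite -[leRHS]mul1r; apply: ler_pM => //.
      by apply: le_trans (idem_mul_le ff _) _; rewrite ipn_koop.
    by rewrite ipn_koop.
  have h2 : `|B f ((koop T1 k p - p) * koop T2 k f)| <= ipn B (koop T1 k p - p).
    have -> : B f ((koop T1 k p - p) * koop T2 k f) =
        B (f * koop T2 k f) (koop T1 k p - p) by rewrite !l2E; congr Ex; ring.
    apply: le_trans (ip_cs _ _ _) _; rewrite -[leRHS]mul1r; apply: ler_pM => //.
    by apply: le_trans (idem_mul_le ff _) _; rewrite ipn_koop.
  have -> : B f (koop T1 k f * koop T2 k f) = B (koop T1 k r * koop T2 k f) f +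
      B f (koop T1 k (p' - p) * koop T2 k f) +
      B f ((koop T1 k p - p) * koop T2 k f) + B f (p * koop T2 k f).
    rewrite (ipC B (_ * _) f) -!ipDr -!mulrDl; congr (B f (_ * _)).
    by rewrite addrA subrK -!koopD /r addrA !subrK.
  move: h1 h2; rewrite !ler_norml => /andP[h1 _] /andP[h2 _]; lra.
have upper : avg (fun k => K k * c k : R^o) a n <= (Ex mu f ^+ 3 - e) * kb.
  rewrite /kb /avg -![_ *: _]/(_ * _) mulrCA ler_wpM2l ?invr_ge0// mulr_sumr.
  apply: ler_sum => i _; rewrite mulrC ler_wpM2r//.
  by rewrite leNgt; apply/negP => lt; apply: no; exists i.
have := le_trans lower upper; rewrite mulrC ler_pM2r//; lra.
Qed.

End khintchine.

(** * Integer powers of an invertible transformation *)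

Section integer_powers.
Context (X : Type).
Implicit Types T : {splitbij [set: X] >-> [set: X]}.

Lemma splitbijK T x : (T^-1)%FUN (T x) = x.
Proof. by apply: funK; rewrite inE. Qed.

Lemma splitbijVK T x : T ((T^-1)%FUN x) = x.
Proof. by apply: invK; rewrite inE. Qed.

Lemma zpowS T n x : zpow T (n + 1) x = T (zpow T n x).
Proof.
case: n => [n|[|n]]; first by rewrite -PoszD addn1.
  by rewrite /= splitbijVK.
have -> : Negz n.+1 + 1 = Negz n by rewrite !NegzE; lia.
by rewrite /= splitbijVK.
Qed.

Lemma zpow_add T m n x : zpow T (m + n) x = zpow T m (zpow T n x).
Proof.
have nat_add (k : nat) l : zpow T (k%:Z + l) x = iter k T (zpow T l x).
  elim: k l => [|k IH] l; first by rewrite add0r.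
  by rewrite iterS -IH -zpowS; congr (zpow T _ x); lia.
case: m => k; first exact: nat_add.
have h : zpow T n x = iter k.+1 T (zpow T (Negz k + n) x).
  by rewrite -nat_add; congr (zpow T _ x); lia.
have iterK j y : iter j (T^-1)%FUN (iter j T y) = y.
  by elim: j => // j IH; rewrite iterSr iterS splitbijK.
by rewrite h -[RHS]/(iter k.+1 (T^-1)%FUN _) iterK.
Qed.

Lemma zpow_comm (g : X -> X) T : (forall x, g (T x) = T (g x)) ->
  forall n x, g (zpow T n x) = zpow T n (g x).
Proof.
move=> gT; have gV x : g ((T^-1)%FUN x) = (T^-1)%FUN (g x).
  by rewrite -{2}(splitbijVK T x) gT splitbijK.
case=> n x; rewrite /zpow.
  by elim: n => //= n IH; rewrite gT IH.
by elim: n => /= [|n IH]; rewrite gV ?IH.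
Qed.

End integer_powers.

Section integer_actions.
Context (d : measure_display) (X : measurableType d) (R : realType).
Variable mu : probability X R.
Implicit Types T : {splitbij [set: X] >-> [set: X]}.

Lemma zpow_measurable T n : invertible_measure_preserving mu T ->
  measurable_fun [set: X] (zpow T n).
Proof.
move=> [[mT _] mV].
have miter (g : X -> X) k :
    measurable_fun [set: X] g -> measurable_fun [set: X] (iter k g).
  by move=> mg; elim: k => [|k IH]; [exact: measurable_id|exact: measurableT_comp].
by case: n => k; exact: miter.
Qed.

Lemma zpow_preserves T n A : invertible_measure_preserving mu T -> measurable A ->
  mu (zpow T n @^-1` A) = mu A.
Proof.
move=> TP mA; have [[mT pT] mV] := TP.
have mpre (g : X -> X) B : measurable_fun [set: X] g -> measurable B ->
    measurable (g @^-1` B).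
  by move=> mg mB; rewrite -[X in measurable X]setTI; exact: mg.
have pV B : measurable B -> mu ((T^-1)%FUN @^-1` B) = mu B.
  move=> mB; rewrite -pT; last exact: mpre.
  by congr (mu _); apply/funext => x; rewrite /preimage /= splitbijK.
have piter (g : X -> X) k : measurable_fun [set: X] g ->
    (forall B, measurable B -> mu (g @^-1` B) = mu B) -> mu (iter k g @^-1` A) = mu A.
  move=> mg pg; elim: k A mA => // k IH A mA.
  by rewrite -[LHS]/(mu (iter k g @^-1` (g @^-1` A))) IH ?pg//; exact: mpre.
by case: n => k; exact: piter.
Qed.

Definition zpow_action T (TP : invertible_measure_preserving mu T) : mp_action mu :=
  @MpAction _ _ _ mu (zpow T) (fun n => zpow_measurable n TP)
    (fun n A => @zpow_preserves T n A TP) (fun=> erefl) (zpow_add T).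

Section quotient.
Variables T1 T2 : {splitbij [set: X] >-> [set: X]}.
Hypothesis T1P : invertible_measure_preserving mu T1.
Hypothesis T2P : invertible_measure_preserving mu T2.
Hypothesis T12 : forall x, T1 (T2 x) = T2 (T1 x).

Lemma zpow_zpow_comm m n x : zpow T1 m (zpow T2 n x) = zpow T2 n (zpow T1 m x).
Proof.
by apply/esym; apply: zpow_comm => y; apply/esym; exact: zpow_comm.
Qed.

(** By commutation the [n]-th power of [T1 T2^-1]; the two factors reduce its properties to those of
    [zpow]. *)
Let quot n x := zpow T1 n (zpow T2 (- n) x).

Fact quot_measurable n : measurable_fun [set: X] (quot n).
Proof. by apply: measurableT_comp; exact: zpow_measurable. Qed.

Fact quot_preserves n A : measurable A -> mu (quot n @^-1` A) = mu A.
Proof.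
move=> mA; rewrite -(zpow_preserves n T1P mA).
rewrite -(@zpow_preserves T2 (- n) (zpow T1 n @^-1` A))//.
by rewrite -[X in measurable X]setTI; exact: zpow_measurable.
Qed.

Fact quot_add m n x : quot (m + n) x = quot m (quot n x).
Proof.
by rewrite /quot opprD !zpow_add (zpow_zpow_comm n (- m)).
Qed.

Definition quot_action : mp_action mu :=
  @MpAction _ _ _ mu quot quot_measurable quot_preserves (fun=> erefl) quot_add.

End quotient.

End integer_actions.

Theorem theorem1p7 (d : measure_display) (X : measurableType d) (R : realType)
    (mu : probability X R) (T1 T2 : {splitbij [set: X] >-> [set: X]})
    (hT1 : invertible_measure_preserving mu T1)
    (hT2 : invertible_measure_preserving mu T2)
    (hcomm : forall x : X, T1 (T2 x) = T2 (T1 x))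
    (erg1 : ergodic mu T1) (erg2 : ergodic mu T2)
    (erg12 : ergodic mu (T1 \o (T2^-1)%FUN))
    (eps : R) (heps : 0 < eps) (A : set X) (hA : measurable A) :
  syndetic [set n : int |
    (mu A ^+ 3 - eps%:E <
     mu (A `&` (zpow T1 n @^-1` A) `&` (zpow T2 n @^-1` A)))%E].
Proof.
have indicP (B : set X) : measurable B -> (\1_B : X -> R) \in @bmeas d X R.
  move=> mB; apply/asboolP; split; first exact: measurable_indic.
  by exists 1 => x; rewrite indicE; case: (x \in B); rewrite ?normr1 ?normr0.
have Eindic (B : set X) (mB : measurable B) : (Ex mu (BFun (indicP B mB)))%:E = mu B.
  by rewrite EFin_Ex /= integral_indic// setIT.
pose f := BFun (indicP A hA).
have ff : f * f = f.
  apply: bfun_ext => x; rewrite bfunE /= indicE.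
  by case: (x \in A); rewrite ?mulr1 ?mulr0.
pose a1 := zpow_action hT1; pose a2 := zpow_action hT2.
pose s := quot_action hT1 hT2 hcomm.
have a1s n x : a1 n x = s n (a2 n x).
  by rewrite /= -zpow_add addNr.
(* At time [1] the three actions compute to [T1], [T2] and [T1 \o T2^-1], so the hypotheses of
   ergodicity apply by conversion. *)
have [L LP] := khintchine a1s hcomm erg1 erg2 erg12 ff heps.
exists L => a; have [i iL iP] := LP a; exists (a + i%:Z); split; first by lia.
set n := a + i%:Z in iP *.
have mT : measurable (A `&` (zpow T1 n @^-1` A) `&` (zpow T2 n @^-1` A)).
  apply: measurableI; first apply: measurableI => //.
    by rewrite -[X in measurable X]setTI; exact: (zpow_measurable n hT1).
  by rewrite -[X in measurable X]setTI; exact: (zpow_measurable n hT2).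
rewrite /mkset -(Eindic A) -(Eindic _ mT).
rewrite l2E in iP.
rewrite (_ : f * _ = BFun (indicP _ mT)) in iP.
  by rewrite -EFin_expe -EFinB lte_fin.
apply: bfun_ext => x; rewrite !bfunE !koopE /= !indicE !in_setI mulrA.
rewrite -!natrM !mulnb; congr (nat_of_bool _)%:R.
Qed.
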